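(* Let $C\in\mathbb{S}^n$, let $\mathcal{A}:\mathbb{S}^n\to\mathbb{R}^m$ be linear, and let $b\in\mathbb{R}^m$. Suppose that the primal solution set $\mathcal{X}_\star$ and the dual solution set $\mathcal{Y}_\star$ are both compact, that strong duality and strict complementarity hold, and that all solutions $X_\star\in\mathcal{X}_\star$ have rank at most $r$. Then for any $\epsilon>0$, the bundle method with cut aggregation and rank-$r$ sketching, with properly chosen parameters, produces a sketched primal solution $\hat X_t$ with $$t\le\widetilde O(1/\epsilon^2)$$ that satisfies $$\mathbb{E}\,\operatorname{dist}_F(\hat X_t,\mathcal{X}_\star)\le\sqrt{\epsilon}.$$
   Context: $\mathbb{S}^n$ is the space of real symmetric $n\times n$ matrices with the trace inner product, $\mathbb{R}^m$ carries the dot product and Euclidean norm $\|\cdot\|$, and $\mathcal{A}^*$ is the adjoint of $\mathcal{A}$. $\operatorname{dist}_F$ denotes distance to a set in Frobenius norm. The expectation is over the random sketching matrices below. $\widetilde O(\cdot)$ hides logarithmic factors in $1/\epsilon$ and constants independent of $\epsilon$. Primal problem: maximize $\langle -C,X\rangle$ over $X\in\mathbb{S}^n$ subject to $\mathcal{A}X=b$, $X\succeq0$; its solution set is $\mathcal{X}_\star$. Dual problem: minimize $\langle -b,y\rangle$ over $y\in\mathbb{R}^m$ subject to $\mathcal{A}^*y\preceq C$; its solution set is $\mathcal{Y}_\star$. Strong duality: there is a pair $(X_\star,y_\star)\in\mathcal{X}_\star\times\mathcal{Y}_\star$ with $\langle -C,X_\star\rangle=\langle -b,y_\star\rangle$.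 Strict complementarity: there is a solution pair $(X_\star,y_\star)\in\mathcal{X}_\star\times\mathcal{Y}_\star$ with $\operatorname{rank}(X_\star)+\operatorname{rank}(C-\mathcal{A}^*y_\star)=n$. Penalized dual objective, for $\alpha>0$: $F(y)=\langle -b,y\rangle-\alpha\min\{\lambda_{\min}(C-\mathcal{A}^*y),0\}$. Bundle method with cut aggregation (parameters $\alpha>0$, $\rho>0$, $\beta\in(0,1)$, starting point $y_1\in\mathbb{R}^m$). Initialize $z_1=y_1$, $X_1=0$, $\bar F^1\equiv-\infty$. For $t=1,2,\dots$: (1) Let $v_t$ be a unit eigenvector of $C-\mathcal{A}^*z_t$ for its smallest eigenvalue if $\lambda_{\min}(C-\mathcal{A}^*z_t)\le0$, and $v_t=0$ otherwise; set $g_t=-b+\alpha\mathcal{A}(v_tv_t^* )\in\partial F(z_t)$. The model of $F$ is $\widetilde F^t(y)=\max\{F(z_t)+\langle g_t,y-z_t\rangle,\ \bar F^t(y)\}$. (2) Compute $$\theta_t=\min\left\{1,\frac{\rho\,(F(z_t)-\bar F^t(z_t))}{\|g_t-\nabla\bar F^t(z_t)\|^2}\right\},\qquad z_{t+1}=y_t-\frac1\rho\left(\theta_tg_t+(1-\theta_t)\nabla\bar F^t(z_t)\right)$$ (for $t=1$, where $\bar F^1\equiv-\infty$, this means $\theta_1=1$ and terms with factor $1-\theta_1$ are omitted). These formulas are presented as an exact solution of the proximal subproblem of minimizing $\widetilde F^t(y)+\frac{\rho}{2}\|y-y_t\|^2$ over $y$. (3) If $F(z_{t+1})\le F(y_t)-\beta\bigl(F(y_t)-\widetilde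 F^t(z_{t+1})\bigr)$, set $y_{t+1}=z_{t+1}$ (descent step); otherwise set $y_{t+1}=y_t$ (null step). (4) Update the aggregate lower bound to the affine function $\bar F^{t+1}(y)=\theta_t\bigl(F(z_t)+\langle g_t,y-z_t\rangle\bigr)+(1-\theta_t)\bar F^t(y)$, whose gradient is $\theta_tg_t+(1-\theta_t)\nabla\bar F^t(z_t)$, and the primal iterate to $X_{t+1}=\theta_t\alpha v_tv_t^*+(1-\theta_t)X_t$. Sketching: before running the method, draw random matrices $\Psi\in\mathbb{R}^{n\times(2r+1)}$ and $\Phi\in\mathbb{R}^{(4r+3)\times n}$ with independent standard normal entries. The sketch of $X_t$ is $Y^C_t=X_t\Psi$, $Y^R_t=\Phi X_t$; it is maintained without forming $X_t$ via $Y^C_{t+1}=\theta_t\alpha v_t(v_t^*\Psi)+(1-\theta_t)Y^C_t$ and $Y^R_{t+1}=\theta_t\alpha(\Phi v_t)v_t^*+(1-\theta_t)Y^R_t$. The sketched primal solution is $\hat X_t=Q_t[B_t]_r$, where $Y^C_t=Q_tR_t$ is a QR factorization, $B_t=(\Phi Q_t)^\dagger Y^R_t$ ($\dagger$ is the pseudoinverse), and $[\cdot]_r$ denotes a best rank-$r$ approximation in Frobenius norm. *)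

(* Defs.v *)
From HB Require Import structures.
From mathcomp Require Import all_boot all_order all_algebra.
From mathcomp Require Import all_classical all_reals all_analysis.

Set Implicit Arguments.
Unset Strict Implicit.
Unset Printing Implicit Defensive.

Import Order.TTheory GRing.Theory Num.Theory.
Import numFieldNormedType.Exports.

Local Open Scope classical_set_scope.
Local Open Scope ring_scope.

(* The trace inner product; on column vectors it is the dot product. *)
Definition inner (R : realType) (m n : nat) (A B : 'M[R]_(m, n)) : R :=
  \tr (A^T *m B).

(* The Frobenius norm, Euclidean on column vectors.  The library norm `|A| of
   a matrix is the maximum norm, hence is not used; the two norms induce the
   same topology. *)
Definition frob (R : realType) (m n : nat) (A : 'M[R]_(m, n)) : R :=
  Num.sqrt (inner A A).

Definition distF (R : realType) (m n : nat) (A : 'M[R]_(m, n))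
    (S : set 'M[R]_(m, n)) : R :=
  inf [set frob (A - Z) | Z in S].

Definition sym_mx (R : realType) (n : nat) (M : 'M[R]_n) : Prop := M^T = M.

Definition psd (R : realType) (n : nat) (M : 'M[R]_n) : Prop :=
  sym_mx M /\ forall x : 'cV[R]_n, 0 <= inner x (M *m x).

(* Meaningful for symmetric M with 0 < n: the set of eigenvalues is then finite
   and nonempty, and its infimum is its minimum. *)
Definition lambda_min (R : realType) (n : nat) (M : 'M[R]_n) : R :=
  inf [set a | eigenvalue M a].

(* A linear map from symmetric matrices to R^m is represented by a linear map A
   on all of 'M_n whose values off the symmetric matrices are never used.
   [adjoint A] is the adjoint of the restriction of A to symmetric matrices;
   see adjoint_sym and adjointP. *)
Definition adjoint (R : realType) (n m : nat)
    (A : {linear 'M[R]_n -> 'cV[R]_m}) (y : 'cV[R]_m) : 'M[R]_n :=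
  \matrix_(i, j) inner y (A (2^-1 *: (delta_mx i j + delta_mx j i))).

Lemma adjoint_sym (R : realType) (n m : nat)
    (A : {linear 'M[R]_n -> 'cV[R]_m}) (y : 'cV[R]_m) :
  sym_mx (adjoint A y).
Proof. by apply/matrixP => i j; rewrite !mxE addrC. Qed.

Lemma adjointP (R : realType) (n m : nat)
    (A : {linear 'M[R]_n -> 'cV[R]_m}) (y : 'cV[R]_m) (X : 'M[R]_n) :
  sym_mx X -> inner (adjoint A y) X = inner y (A X).
Proof.
move=> symX.
have XE : X = \sum_i \sum_j X i j *: (2^-1 *: (delta_mx i j + delta_mx j i)).
  have XT : \sum_i \sum_j X i j *: delta_mx j i = X.
    rewrite -[RHS]symX [X in X^T]matrix_sum_delta linear_sum /=.
    apply: eq_bigr => i _; rewrite linear_sum /=; apply: eq_bigr => j _.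
    by rewrite linearZ /= trmx_delta.
  transitivity (2^-1 *: (X + X)).
    by rewrite -[X + X]mulr2n -[X *+ 2]scaler_nat scalerA mulVf ?scale1r ?pnatr_eq0.
  rewrite {1}[X in X + _]matrix_sum_delta -[X in _ + X]XT -big_split scaler_sumr.
  apply: eq_bigr => i _; rewrite -big_split scaler_sumr.
  by apply: eq_bigr => j _; rewrite /= -scalerDr !scalerA mulrC.
have innerZ (a : R) (u : 'cV[R]_m) : inner y (a *: u) = a * inner y u.
  by rewrite /inner -scalemxAr linearZ.
rewrite [in RHS]XE linear_sum /inner mulmx_sumr linear_sum /= /mxtrace.
transitivity (\sum_i \sum_j adjoint A y i j * X i j).
  rewrite exchange_big /=; apply: eq_bigr => j _; rewrite !mxE.
  by apply: eq_bigr => i _; rewrite mxE.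
apply: eq_bigr => i _; rewrite -/(mxtrace _).
rewrite linear_sum mulmx_sumr linear_sum /=; apply: eq_bigr => j _.
by rewrite linearZ -/(inner _ _) innerZ mxE mulrC.
Qed.

Section SDP.
Variables (R : realType) (n m : nat).
Variables (C : 'M[R]_n) (A : {linear 'M[R]_n -> 'cV[R]_m}) (b : 'cV[R]_m).

Definition primal_feasible : set 'M[R]_n :=
  [set X | [/\ sym_mx X, A X = b & psd X]].

Definition primal_sol : set 'M[R]_n :=
  [set X | primal_feasible X /\
    forall X', primal_feasible X' -> inner (- C) X' <= inner (- C) X].

Definition dual_slack (y : 'cV[R]_m) : 'M[R]_n := C - adjoint A y.

Definition dual_feasible : set 'cV[R]_m := [set y | psd (dual_slack y)].

Definition dual_sol : set 'cV[R]_m :=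
  [set y | dual_feasible y /\
    forall y', dual_feasible y' -> inner (- b) y <= inner (- b) y'].

Definition strong_duality : Prop :=
  exists X y, [/\ primal_sol X, dual_sol y & inner (- C) X = inner (- b) y].

Definition strict_complementarity : Prop :=
  exists X y, [/\ primal_sol X, dual_sol y
    & (\rank X + \rank (dual_slack y) = n)%N].

Definition penalized (alpha : R) (y : 'cV[R]_m) : R :=
  inner (- b) y - alpha * Num.min (lambda_min (dual_slack y)) 0.

(* The sequences generated by the bundle method, indexed from t = 1 (their
   values at t = 0 are irrelevant): the iterates y_t, z_t and X_t, the
   eigenvector v_t, the weight theta_t, the aggregate lower bound (-oo at t = 1)
   and its gradient (irrelevant at t = 1). *)
Record trajectory := Trajectory {
  by_ : nat -> 'cV[R]_m;
  bz : nat -> 'cV[R]_m;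
  bX : nat -> 'M[R]_n;
  bv : nat -> 'cV[R]_n;
  btheta : nat -> R;
  bagg : nat -> 'cV[R]_m -> \bar R;
  bgrad : nat -> 'cV[R]_m }.

Definition cut_vector (M : 'M[R]_n) (v : 'cV[R]_n) : Prop :=
  if lambda_min M <= 0 then M *m v = lambda_min M *: v /\ frob v = 1
  else v = 0.

Definition cut_grad (alpha : R) (s : trajectory) (t : nat) : 'cV[R]_m :=
  - b + alpha *: A (bv s t *m (bv s t)^T).

Definition cut (alpha : R) (s : trajectory) (t : nat) (y : 'cV[R]_m) : R :=
  penalized alpha (bz s t) + inner (cut_grad alpha s t) (y - bz s t).

Definition model (alpha : R) (s : trajectory) (t : nat) (y : 'cV[R]_m) :
    \bar R :=
  Order.max (cut alpha s t y)%:E (bagg s t y).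

(* When the denominator vanishes for 1 < t, the quotient is read as +oo (the two
   pieces of the model then have the same gradient and the first one is the
   larger), so that theta_t = 1; in the library x / 0 = 0 would give 0. *)
Definition step_weight (alpha rho : R) (s : trajectory) (t : nat) : R :=
  let g := cut_grad alpha s t in
  if (t == 1)%N || (g == bgrad s t) then 1
  else Num.min 1
    (rho * (penalized alpha (bz s t) - fine (bagg s t (bz s t)))
       / frob (g - bgrad s t) ^+ 2).

Definition descent_test (alpha beta : R) (s : trajectory) (t : nat) : Prop :=
  let Fy := penalized alpha (by_ s t) in
  ((penalized alpha (bz s t.+1))%:E <=
     Fy%:E - beta%:E * (Fy%:E - model alpha s t (bz s t.+1)))%E.

(* In run_agg at t = 1, the term (1 - theta_1) * -oo equals 0 * -oo = 0, as
   theta_1 = 1. *)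
Record bundle_run (alpha rho beta : R) (y1 : 'cV[R]_m) (s : trajectory) :
    Prop := BundleRun {
  run_z1 : bz s 1 = y1;
  run_y1 : by_ s 1 = y1;
  run_X1 : bX s 1 = 0;
  run_agg1 : forall y, bagg s 1 y = -oo%E;
  run_v : forall t, (1 <= t)%N -> cut_vector (dual_slack (bz s t)) (bv s t);
  run_theta : forall t, (1 <= t)%N -> btheta s t = step_weight alpha rho s t;
  run_z : forall t, (1 <= t)%N ->
    bz s t.+1 = by_ s t - rho^-1 *:
      (btheta s t *: cut_grad alpha s t + (1 - btheta s t) *: bgrad s t);
  run_descent : forall t, (1 <= t)%N ->
    descent_test alpha beta s t -> by_ s t.+1 = bz s t.+1;
  run_null : forall t, (1 <= t)%N ->
    ~ descent_test alpha beta s t -> by_ s t.+1 = by_ s t;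
  run_agg : forall t, (1 <= t)%N -> forall y,
    bagg s t.+1 y = ((btheta s t)%:E * (cut alpha s t y)%:E
                       + (1 - btheta s t)%:E * bagg s t y)%E;
  run_grad : forall t, (1 <= t)%N ->
    bgrad s t.+1 =
      btheta s t *: cut_grad alpha s t + (1 - btheta s t) *: bgrad s t;
  run_X : forall t, (1 <= t)%N ->
    bX s t.+1 = (btheta s t * alpha) *: (bv s t *m (bv s t)^T)
                  + (1 - btheta s t) *: bX s t }.

End SDP.

(* The Moore-Penrose pseudoinverse, given by its four defining equations. *)
Definition moore_penrose (R : realType) (m n : nat) (M : 'M[R]_(m, n))
    (N : 'M[R]_(n, m)) : Prop :=
  [/\ M *m N *m M = M, N *m M *m N = N,
      (M *m N)^T = M *m N & (N *m M)^T = N *m M].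

Definition pseudoinverse (R : realType) (m n : nat) (M : 'M[R]_(m, n)) :
    'M[R]_(n, m) :=
  xget 0 [set N | moore_penrose M N].

(* Thin QR factorization: Q has p = min(n, k) columns, see qr_routine. *)
Definition thin_qr (R : realType) (n k p : nat) (Y : 'M[R]_(n, k))
    (Q : 'M[R]_(n, p)) (U : 'M[R]_(p, k)) : Prop :=
  [/\ Y = Q *m U, Q^T *m Q = 1%:M
    & forall (i : 'I_p) (j : 'I_k), (j < i)%N -> U i j = 0].

Definition best_rank_approx (R : realType) (p n r : nat) (B Z : 'M[R]_(p, n)) :
    Prop :=
  (\rank Z <= r)%N /\
  forall Z' : 'M[R]_(p, n), (\rank Z' <= r)%N -> frob (B - Z) <= frob (B - Z').

Definition borel (S T : topologicalType) (f : S -> T) : Prop :=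
  forall U : set T, open U -> <<s open >> (f @^-1` U).

(* QR factorizations and best rank-r approximations are not unique.  The method
   uses fixed routines computing them, arbitrary except that they are Borel, so
   that the sketched solution is a random variable. *)
Definition qr_routine (R : realType) (n k : nat)
    (qr : 'M[R]_(n, k) -> 'M[R]_(n, minn n k) * 'M[R]_(minn n k, k)) : Prop :=
  (forall Y, thin_qr Y (qr Y).1 (qr Y).2) /\ borel (fun Y => (qr Y).1).

Definition rank_routine (R : realType) (p n r : nat)
    (trunc : 'M[R]_(p, n) -> 'M[R]_(p, n)) : Prop :=
  (forall B, best_rank_approx r B (trunc B)) /\ borel trunc.

Definition sketched_solution (R : realType) (n k l : nat)
    (qr : 'M[R]_(n, k) -> 'M[R]_(n, minn n k) * 'M[R]_(minn n k, k))
    (trunc : 'M[R]_(minn n k, n) -> 'M[R]_(minn n k, n))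
    (Psi : 'M[R]_(n, k)) (Phi : 'M[R]_(l, n)) (X : 'M[R]_n) : 'M[R]_n :=
  let YC := X *m Psi in
  let YR := Phi *m X in
  let Q := (qr YC).1 in
  let B := pseudoinverse (Phi *m Q) *m YR in
  Q *m trunc B.

Definition mutually_independent (R : realType) (d : measure_display)
    (Omega : measurableType d) (P : probability Omega R) (I : finType)
    (X : I -> {RV P >-> R}) : Prop :=
  forall (J : {set I}) (E : I -> set R), (forall i, measurable (E i)) ->
    P (\bigcap_(i in [set` J]) (X i @^-1` E i)) =
    (\prod_(i in J) P (X i @^-1` E i))%E.

Definition gaussian_sketch (R : realType) (d : measure_display)
    (Omega : measurableType d) (P : probability Omega R) (n k l : nat)
    (Psi : 'I_n -> 'I_k -> {RV P >-> R})
    (Phi : 'I_l -> 'I_n -> {RV P >-> R}) : Prop :=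
  let entry (e : 'I_n * 'I_k + 'I_l * 'I_n) :=
    match e with
    | inl ij => Psi ij.1 ij.2
    | inr ij => Phi ij.1 ij.2
    end in
  mutually_independent entry /\
  forall e (E : set R), measurable E ->
    distribution P (entry e) E = normal_prob 0 1 E.

Definition random_matrix (R : realType) (d : measure_display)
    (Omega : measurableType d) (P : probability Omega R) (m n : nat)
    (X : 'I_m -> 'I_n -> {RV P >-> R}) (w : Omega) : 'M[R]_(m, n) :=
  \matrix_(i, j) X i j w.

(* f(e) = O~(g(e)) as e decreases to 0. *)
Definition softO_at0 (R : realType) (f g : R -> R) : Prop :=
  exists (K : R) (p : nat),
    \forall e \near 0^'+, `|f e| <= K * `|ln e^-1 ^+ p * g e|.

(* Main.v *)
Require Import Defs.
From HB Require Import structures.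
From mathcomp Require Import all_boot all_order all_algebra.
From mathcomp Require Import all_classical all_reals all_analysis.
From mathcomp Require Import measurable_realfun.
From mathcomp Require Import ring lra zify.

Set Implicit Arguments.
Unset Strict Implicit.
Unset Printing Implicit Defensive.

Import Order.TTheory GRing.Theory Num.Theory.
Import numFieldNormedType.Exports.

Local Open Scope classical_set_scope.
Local Open Scope ring_scope.

(* Fix alpha = 1 + tr Xs for a strictly complementary solution pair (Xs, ys), put
   S = C - A^* ys, take rho proportional to eps and beta = 1 / (1 + rho).

   Bundle method. Up to the first descent step the centre is y1 and every step is
   an exact proximal step for the model. The gap e_t between the optimal value and
   the value of the proximal problem for the aggregate satisfies
   e_(t+1) <= e_t - rho e_t^2 / (2 G) along null steps, hence e_t <= rho after
   O(1/rho^2) of them; and as 1 - beta is about rho, a descent step already forces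
   e_(t+1) = O(rho). In both cases X_t satisfies |A X_t - b| = O(rho) and
   <S, X_t> = O(rho).

   Growth. Under strict complementarity these two bounds put X_t at distance
   O(sqrt rho) from a solution W N W^T, where the columns of W span the range of
   Xs, that is, ker S; the matrix W does not depend on t.

   Sketch. The distance of the sketched solution to W N W^T is at most
   |X_t - W N W^T| times a factor controlled by the entries of Psi and Phi and by
   the smallest singular values of Psi^T W and Phi Q, where Q depends on Psi only.
   These are bounded below outside events of small probability by a grid argument,
   where for each grid point a single Gaussian entry per row is resampled. The
   tails decay fast enough for the factor to have a finite expectation. *)

(** * Trace inner product and Frobenius norm *)

(** The weight [theta_t] solves the proximal subproblem only if [z_t] is the proximal point of the
    aggregate for the current centre. After a descent step [z_t] is the centre itself, so the usual
    analysis of null steps breaks off there. Nothing is claimed about later iterates: with [beta]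
    this close to 1, a descent step is accepted only when the model value at the trial point is
    already nearly optimal, and the next primal iterate serves as output. With the centre fixed the
    gap decays like 1 / (rho t), so a target gap of order rho costs 1 / rho^2 steps.

    The run is deterministic: [t] and [X_t] do not depend on the sketch, but they vary with epsilon.
    Every constant of the random part is therefore fixed before the sketched matrix is given, and
    the random distance is dominated by the distance to a single deterministic solution, which
    dispenses with a measurable choice of nearest solutions. *)

Section InnerProduct.
Variable R : realType.
Implicit Types (m n p : nat) (a : R).

Lemma inner_sumE m n (A B : 'M[R]_(m, n)) :
  inner A B = \sum_i \sum_j A i j * B i j.
Proof.
rewrite /inner /mxtrace exchange_big /=; apply: eq_bigr => j _.
by rewrite !mxE; apply: eq_bigr => i _; rewrite mxE.
Qed.

Lemma innerC m n (A B : 'M[R]_(m, n)) : inner A B = inner B A.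
Proof. by rewrite /inner -mxtrace_tr trmx_mul trmxK. Qed.

Lemma innerDr m n (A B D : 'M[R]_(m, n)) :
  inner A (B + D) = inner A B + inner A D.
Proof. by rewrite /inner mulmxDr mxtraceD. Qed.

Lemma innerZr m n a (A B : 'M[R]_(m, n)) : inner A (a *: B) = a * inner A B.
Proof. by rewrite /inner -scalemxAr mxtraceZ. Qed.

Lemma innerNr m n (A B : 'M[R]_(m, n)) : inner A (- B) = - inner A B.
Proof. by rewrite -scaleN1r innerZr mulN1r. Qed.

Lemma innerBr m n (A B D : 'M[R]_(m, n)) :
  inner A (B - D) = inner A B - inner A D.
Proof. by rewrite innerDr innerNr. Qed.

Lemma innerDl m n (A B D : 'M[R]_(m, n)) :
  inner (A + B) D = inner A D + inner B D.
Proof. by rewrite innerC innerDr !(innerC D). Qed.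

Lemma innerZl m n a (A B : 'M[R]_(m, n)) : inner (a *: A) B = a * inner A B.
Proof. by rewrite innerC innerZr innerC. Qed.

Lemma innerNl m n (A B : 'M[R]_(m, n)) : inner (- A) B = - inner A B.
Proof. by rewrite innerC innerNr innerC. Qed.

Lemma innerBl m n (A B D : 'M[R]_(m, n)) :
  inner (A - B) D = inner A D - inner B D.
Proof. by rewrite innerDl innerNl. Qed.

Definition innerE := (innerDl, innerDr, innerBl, innerBr, innerNl, innerNr,
  innerZl, innerZr).

Lemma inner0r m n (A : 'M[R]_(m, n)) : inner A 0 = 0.
Proof. by rewrite /inner mulmx0 mxtrace0. Qed.

Lemma inner_mulr m n p (A : 'M[R]_(m, n)) (B : 'M[R]_(m, p)) (D : 'M[R]_(p, n)) :
  inner A (B *m D) = inner (B^T *m A) D.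
Proof. by rewrite /inner trmx_mul trmxK mulmxA. Qed.

Lemma inner_mull m n p (A : 'M[R]_(m, n)) (B : 'M[R]_(m, p)) (D : 'M[R]_(p, n)) :
  inner A (B *m D) = inner (A *m D^T) B.
Proof. by rewrite /inner trmx_mul trmxK mulmxA mxtrace_mulC mulmxA. Qed.

Lemma inner_trmx m n (A B : 'M[R]_(m, n)) : inner A^T B^T = inner A B.
Proof. by rewrite /inner trmxK mxtrace_mulC -mxtrace_tr trmx_mul trmxK. Qed.

Lemma inner_ge0 m n (A : 'M[R]_(m, n)) : 0 <= inner A A.
Proof.
by rewrite inner_sumE; apply: sumr_ge0 => i _; apply: sumr_ge0 => j _; exact: sqr_ge0.
Qed.

Lemma entry_sqr_le m n (A : 'M[R]_(m, n)) i j : A i j ^+ 2 <= inner A A.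
Proof.
rewrite inner_sumE (bigD1 i) //= (bigD1 j) //= -expr2 -addrA lerDl.
apply: addr_ge0; first by apply: sumr_ge0 => k _; exact: sqr_ge0.
by apply: sumr_ge0 => k _; apply: sumr_ge0 => l _; exact: sqr_ge0.
Qed.

Lemma inner_eq0 m n (A : 'M[R]_(m, n)) : inner A A = 0 -> A = 0.
Proof.
move=> A0; apply/matrixP => i j; rewrite mxE; apply/eqP.
by rewrite -sqrf_eq0 eq_le sqr_ge0 -{1}A0 entry_sqr_le.
Qed.

Lemma frob_ge0 m n (A : 'M[R]_(m, n)) : 0 <= frob A.
Proof. exact: sqrtr_ge0. Qed.

Lemma frob_sqr m n (A : 'M[R]_(m, n)) : frob A ^+ 2 = inner A A.
Proof. by rewrite sqr_sqrtr // inner_ge0. Qed.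

Lemma frob_le m n (A : 'M[R]_(m, n)) a :
  0 <= a -> inner A A <= a ^+ 2 -> frob A <= a.
Proof.
by move=> a0; rewrite -frob_sqr ler_pXn2r // nnegrE // frob_ge0.
Qed.

Lemma frob0 m n : frob (0 : 'M[R]_(m, n)) = 0.
Proof. by rewrite /frob inner0r sqrtr0. Qed.

Lemma frob_eq0 m n (A : 'M[R]_(m, n)) : frob A = 0 -> A = 0.
Proof. by move=> A0; apply: inner_eq0; rewrite -frob_sqr A0 expr0n. Qed.

Lemma frobZ m n a (A : 'M[R]_(m, n)) : frob (a *: A) = `|a| * frob A.
Proof.
by rewrite /frob innerZl innerZr mulrA -expr2 sqrtrM ?sqr_ge0 // sqrtr_sqr.
Qed.

Lemma frobN m n (A : 'M[R]_(m, n)) : frob (- A) = frob A.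
Proof. by rewrite -scaleN1r frobZ normrN1 mul1r. Qed.

Lemma frob_trmx m n (A : 'M[R]_(m, n)) : frob A^T = frob A.
Proof. by rewrite /frob inner_trmx. Qed.

Lemma inner_cauchy m n (A B : 'M[R]_(m, n)) :
  inner A B ^+ 2 <= inner A A * inner B B.
Proof.
have [B0|B0] := eqVneq (inner B B) 0.
  by rewrite (inner_eq0 B0) !inner0r mulr0 expr0n.
have Bp : 0 < inner B B by rewrite lt_def B0 inner_ge0.
have := inner_ge0 (inner B B *: A - inner A B *: B).
rewrite !innerE (innerC B A) => H.
have : 0 <= inner B B * (inner A A * inner B B - inner A B ^+ 2) by lra.
by rewrite pmulr_rge0 // subr_ge0.
Qed.

Lemma inner_le_frob m n (A B : 'M[R]_(m, n)) : `|inner A B| <= frob A * frob B.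
Proof.
rewrite -sqrtr_sqr /frob -sqrtrM ?inner_ge0 //.
by rewrite ler_wsqrtr // inner_cauchy.
Qed.

Lemma frobD m n (A B : 'M[R]_(m, n)) : frob (A + B) <= frob A + frob B.
Proof.
apply: frob_le; first by rewrite addr_ge0 // frob_ge0.
have := ler_norm (inner A B); have := inner_le_frob A B.
rewrite !innerE -!frob_sqr (innerC B A); lra.
Qed.

Lemma frobB m n (A B : 'M[R]_(m, n)) : frob (A - B) <= frob A + frob B.
Proof. by rewrite -(frobN B) frobD. Qed.

Lemma frob_entry m n (A : 'M[R]_(m, n)) i j : `|A i j| <= frob A.
Proof. by rewrite -sqrtr_sqr ler_wsqrtr // entry_sqr_le. Qed.

Lemma frob_le_entry m n (A : 'M[R]_(m, n)) a :
  0 <= a -> (forall i j, `|A i j| <= a) -> frob A <= (m * n)%:R * a.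
Proof.
move=> a0 Aa; apply: frob_le; first by rewrite mulr_ge0.
apply: (@le_trans _ _ (\sum_(i < m) \sum_(j < n) a ^+ 2)).
  rewrite inner_sumE; apply: ler_sum => i _; apply: ler_sum => j _.
  by rewrite -expr2 -real_normK ?num_real // lerXn2r // nnegrE.
rewrite !sumr_const !card_ord -mulrnA -[leLHS]mulr_natl exprMn.
apply: ler_wpM2r; first exact: sqr_ge0.
by rewrite mulnC -natrX ler_nat; case: (m * n)%N => // k; rewrite leq_pmulr.
Qed.

Lemma frobM m n p (A : 'M[R]_(m, n)) (B : 'M[R]_(n, p)) :
  frob (A *m B) <= frob A * frob B.
Proof.
apply: frob_le; first by rewrite mulr_ge0 // frob_ge0.
rewrite exprMn !frob_sqr [leLHS]inner_sumE.
apply: (@le_trans _ _ (\sum_i \sum_j inner (row i A)  (row i A) *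
                                inner (col j B) (col j B))).
  apply: ler_sum => i _; apply: ler_sum => j _; rewrite -expr2.
  have -> : (A *m B) i j = inner (row i A)^T (col j B).
    rewrite /inner trmxK /mxtrace big_ord1 !mxE.
    by apply: eq_bigr => k _; rewrite !mxE.
  by rewrite (le_trans (inner_cauchy _ _)) // inner_trmx.
under eq_bigr do rewrite -mulr_sumr.
rewrite -mulr_suml ler_pM //.
- by apply: sumr_ge0 => i _; exact: inner_ge0.
- by apply: sumr_ge0 => i _; exact: inner_ge0.
- rewrite [leRHS]inner_sumE; apply: ler_sum => i _.
  by rewrite inner_sumE big_ord1; under eq_bigr do rewrite mxE.
rewrite [leRHS]inner_sumE [leRHS]exchange_big /=; apply: ler_sum => i _.
by rewrite inner_sumE; apply: ler_sum => j _; rewrite big_ord1 !mxE.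
Qed.

Lemma frobM_le m n p (A : 'M[R]_(m, n)) (B : 'M[R]_(n, p)) a c :
  frob A <= a -> frob B <= c -> frob (A *m B) <= a * c.
Proof.
by move=> Aa Bc; rewrite (le_trans (frobM _ _)) // ler_pM // frob_ge0.
Qed.

Lemma linear_frob_le m n p q (f : {linear 'M[R]_(m, n) -> 'M[R]_(p, q)}) :
  exists2 K, 0 <= K & forall X, frob (f X) <= K * frob X.
Proof.
exists (\sum_i \sum_j frob (f (delta_mx i j))).
  by apply: sumr_ge0 => i _; apply: sumr_ge0 => j _; exact: frob_ge0.
move=> X; rewrite [in leLHS](matrix_sum_delta X) linear_sum mulr_suml.
have big_frob (I : finType) (F : I -> 'M[R]_(p, q)) :
    frob (\sum_i F i) <= \sum_i frob (F i).
  elim/big_rec2: _ => [|i y1 y2 _ H]; first by rewrite frob0.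
  by rewrite (le_trans (frobD _ _)) // lerD2l.
apply: (le_trans (big_frob _ _)); apply: ler_sum => i _.
rewrite linear_sum mulr_suml (le_trans (big_frob _ _)) //.
apply: ler_sum => j _.
by rewrite linearZ frobZ mulrC ler_wpM2l ?frob_ge0 // frob_entry.
Qed.

End InnerProduct.

(** * Positive semidefinite matrices *)

Section PSD.
Variable R : realType.
Implicit Types (m n p : nat) (a : R).

Lemma inner_rank1 n (u x y : 'cV[R]_n) :
  inner x (u *m u^T *m y) = inner u x * inner u y.
Proof.
rewrite -mulmxA inner_mulr.
have E (v : 'cV[R]_n) : u^T *m v = (inner u v)%:M.
  by rewrite /inner [LHS]mx11_scalar /mxtrace big_ord1.
by rewrite !E inner_sumE !big_ord1 !mxE.
Qed.

Lemma sym_inner n (M : 'M[R]_n) (x y : 'cV[R]_n) :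
  sym_mx M -> inner x (M *m y) = inner y (M *m x).
Proof. by move=> symM; rewrite inner_mulr symM innerC. Qed.

Lemma psd_cauchy n (M : 'M[R]_n) (x y : 'cV[R]_n) : psd M ->
  inner x (M *m y) ^+ 2 <= inner x (M *m x) * inner y (M *m y).
Proof.
move=> [symM posM].
set c := inner x (M *m y); set p := inner x (M *m x); set q := inner y (M *m y).
have H s t : 0 <= s ^+ 2 * p + 2 * s * t * c + t ^+ 2 * q.
  have := posM (s *: x + t *: y); rewrite mulmxDr -!scalemxAr !innerE.
  rewrite -/p -/q -/c (sym_inner y x symM) -/c; lra.
have p0 : 0 <= p by exact: posM.
have q0 : 0 <= q by exact: posM.
have [qE|qE] := eqVneq q 0.
  (* For [q = 0] these coefficients reduce the form to [- c ^+ 2]. *)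
  have := H c (- (p + 1) / 2); rewrite qE => {}H.
  have : 0 <= - c ^+ 2 by lra.
  lra.
have qp : 0 < q by rewrite lt_def qE.
have := H q (- c) => {}H.
have : 0 <= q * (p * q - c ^+ 2) by lra.
by rewrite pmulr_rge0 // subr_ge0.
Qed.

Lemma psd_gram n p (B : 'M[R]_(n, p)) : psd (B *m B^T).
Proof.
split; first by rewrite /sym_mx trmx_mul trmxK.
by move=> x; rewrite -mulmxA inner_mulr inner_ge0.
Qed.

(** Induction on the rank, in place of a spectral decomposition. For [w] with <w, X w> positive,
    subtracting u u^T with u = X w / sqrt <w, X w> keeps the matrix positive semidefinite by
    [psd_cauchy] and puts [w] into its kernel, so the rank drops. *)
Lemma psd_factor n (X : 'M[R]_n) : psd X ->
  exists p, exists B : 'M[R]_(n, p), X = B *m B^T.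
Proof.
elim: {X}(\rank X).+1 {-2}X (ltnSn (\rank X)) => // k IH X rX psdX.
have [X0|X0] := eqVneq X 0.
  by exists 0, 0; rewrite X0 mul0mx.
have [symX posX] := psdX.
have [w w0] : exists w : 'cV[R]_n, inner w (X *m w) != 0.
  apply: contrapT => /forallNP H; move/eqP: X0; apply.
  have {}H (x y : 'cV[R]_n) : inner x (X *m y) = 0.
    apply/eqP; rewrite -sqrf_eq0 eq_le sqr_ge0 andbT.
    have := psd_cauchy x y psdX; suff -> : inner x (X *m x) = 0 by rewrite mul0r.
    by apply/eqP; have := H x; move/negP; rewrite negbK.
  rewrite -[X]mulmx1; apply/matrixP => i j.
  have := inner_eq0 (H (X *m col j 1%:M) (col j 1%:M)).
  by rewrite colE mulmxA => /matrixP/(_ i 0); rewrite -colE !mxE.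
set c := inner w (X *m w) in w0.
have cp : 0 < c by rewrite lt_def w0 posX.
have [u uE] : exists u, u = (Num.sqrt c)^-1 *: (X *m w) by eexists.
have sc : Num.sqrt c != 0 by rewrite sqrtr_eq0 -ltNge.
have sc2 : Num.sqrt c * Num.sqrt c = c by rewrite -expr2 sqr_sqrtr // ltW.
have ux x : inner u x = (Num.sqrt c)^-1 * inner w (X *m x).
  by rewrite uE innerZl innerC (sym_inner _ _ symX).
have psdX' : psd (X - u *m u^T).
  split; first by rewrite /sym_mx linearB /= symX trmx_mul trmxK.
  move=> x; rewrite mulmxBl innerBr inner_rank1 !ux subr_ge0 mulrACA -invfM sc2.
  rewrite mulrC ler_pdivrMr // -expr2 mulrC; exact: psd_cauchy.
have rX' : (\rank (X - u *m u^T)%R < k)%N.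
  apply: (@leq_trans (\rank X)); last by rewrite -ltnS.
  apply: rank_ltmx; rewrite ltmxE.
  apply/andP; split.
    apply/submxP; exists (1%:M - (Num.sqrt c)^-1 *: (u *m w^T)).
    have uT : u^T = (Num.sqrt c)^-1 *: (w^T *m X).
      by rewrite uE linearZ /= trmx_mul symX.
    by rewrite uT -scalemxAr mulmxBl mul1mx -scalemxAl mulmxA.
  apply/negP => /submxP[D XE]; move: w0; rewrite /c XE -mulmxA mulmxBl.
  have -> : u *m u^T *m w = X *m w.
    rewrite -mulmxA.
    have -> : u^T *m w = (inner u w)%:M.
      by rewrite /inner [LHS]mx11_scalar /mxtrace big_ord1.
    rewrite mul_mx_scalar ux -/c uE scalerA.
    suff -> : (Num.sqrt c)^-1 * c * (Num.sqrt c)^-1 = 1 by rewrite scale1r.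
    by rewrite mulrAC -invfM sc2 mulVf // gt_eqF.
  by rewrite subrr mulmx0 inner0r eqxx.
have [p [B BE]] := IH _ rX' psdX'.
exists (1 + p)%N, (row_mx u B).
by rewrite tr_row_mx mul_row_col -BE addrC subrK.
Qed.

Lemma psd_inner_ge0 n (X Y : 'M[R]_n) : psd X -> psd Y -> 0 <= inner X Y.
Proof.
move=> /psd_factor[p [B ->]] /psd_factor[q [D ->]].
by rewrite inner_mull trmxK innerC -mulmxA inner_mulr inner_ge0.
Qed.

End PSD.

(** * The smallest eigenvalue as a lower bound of the quadratic form *)

Section SmallestEigenvalue.
Variable R : realType.
Implicit Types (n : nat).

Lemma quad_le n (M : 'M[R]_n) (x : 'cV[R]_n) :
  `|inner x (M *m x)| <= frob M * inner x x.
Proof.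
apply: le_trans (inner_le_frob _ _) _.
rewrite -frob_sqr expr2 mulrA [leRHS]mulrC ler_wpM2l ?frob_ge0 //.
exact: frobM.
Qed.

(** [psd_cauchy] for x and N^-1 x bounds <x, x>^2 by <x, N x> <x, N^-1 x>, and the last factor is at
    most |N^-1| <x, x>. *)
Lemma psd_unit_lower n (N : 'M[R]_n) : psd N -> N \in unitmx ->
  exists2 k, 0 < k & forall x : 'cV[R]_n, k * inner x x <= inner x (N *m x).
Proof.
move=> psdN uN; exists (frob (invmx N) + 1)^-1.
  by rewrite invr_gt0 ltr_wpDl // frob_ge0.
move=> x; rewrite ler_pdivrMl; last by rewrite ltr_wpDl // frob_ge0.
have [x0|x0] := eqVneq (inner x x) 0.
  by rewrite x0 mulr_ge0 ?addr_ge0 ?frob_ge0 //; case: psdN.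
have xp : 0 < inner x x by rewrite lt_def x0 inner_ge0.
rewrite -(ler_pM2r xp) -expr2.
have := psd_cauchy x (invmx N *m x) psdN.
rewrite mulmxA mulmxV // mul1mx => /le_trans; apply.
rewrite [leRHS]mulrAC [leRHS]mulrC ler_wpM2l //; first by case: psdN.
rewrite innerC (le_trans (ler_norm _)) // (le_trans (quad_le _ _)) //.
by rewrite ler_wpM2r ?inner_ge0 // lerDl.
Qed.

(** The infimum [mu] of the Rayleigh quotient is an eigenvalue, which is shown without a minimizer:
    were M - mu invertible, [psd_unit_lower] would give a larger lower bound than [mu]. Hence
    [lambda_min M] is at most [mu]. *)
Lemma lambda_min_le n (M : 'M[R]_n) (x : 'cV[R]_n) : sym_mx M ->
  lambda_min M * inner x x <= inner x (M *m x).
Proof.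
case: n => [|n] in M x *; first by rewrite (flatmx0 x) mulmx0 !inner0r mulr0.
move=> symM.
pose E := [set inner v (M *m v) | v in [set v : 'cV[R]_n.+1 | inner v v = 1]].
have infE : has_inf E.
  split.
    pose d0 : 'cV[R]_n.+1 := delta_mx 0 0.
    exists (inner d0 (M *m d0)); exists d0 => //=.
    rewrite inner_sumE (bigD1 0) //= big_ord1 big1 ?addr0 ?mxE ?mulr1 //.
    by move=> i i0; rewrite big_ord1 mxE (negPf i0) mul0r.
  exists (- frob M) => _ [v /= v1 <-]; have := quad_le M v.
  by rewrite v1 mulr1 ler_norml => /andP[].
set mu := inf E.
have psdM : psd (M - mu%:M).
  split; first by rewrite /sym_mx linearB /= symM tr_scalar_mx.
  move=> v; rewrite mulmxBl innerBr mul_scalar_mx innerZr subr_ge0.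
  have [v0|v0] := eqVneq (inner v v) 0.
    by rewrite (inner_eq0 v0) mulmx0 !inner0r mulr0.
  have vp : 0 < inner v v by rewrite lt_def v0 inner_ge0.
  have fp : 0 < frob v by rewrite sqrtr_gt0.
  have : mu <= inner ((frob v)^-1 *: v) (M *m ((frob v)^-1 *: v)).
    apply: ge_inf; first by case: infE.
    exists ((frob v)^-1 *: v) => //=.
    by rewrite innerZl innerZr -frob_sqr mulrA -expr2 -exprMn mulVf ?gt_eqF // expr1n.
  rewrite -scalemxAr innerZl innerZr mulrA -expr2 exprVn frob_sqr.
  by rewrite ler_pdivlMl // mulrC.
have eig : eigenvalue M mu.
  rewrite /eigenvalue /eigenspace kermx_eq0 row_free_unit; apply/negP => uM.
  have [k k0 kM] := psd_unit_lower psdM uM.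
  suff : mu + k <= mu by rewrite gerDl leNgt k0.
  apply: lb_le_inf; first by case: infE.
  move=> _ [v /= v1 <-]; have := kM v.
  by rewrite mulmxBl innerBr mul_scalar_mx innerZr v1 !mulr1 lerBrDl.
apply: (@le_trans _ _ (mu * inner x x)).
  apply: ler_wpM2r; first exact: inner_ge0.
  apply: ge_inf => //; exists (- frob M) => a /eigenvalueP[v vM v0].
  have : `|a| <= frob M.
    have vp : 0 < inner v v.
      by rewrite lt_def inner_ge0 andbT; apply: contra_neq v0 => /inner_eq0.
    rewrite -(ler_pM2r vp) -[X in _ * X](ger0_norm (ltW vp)) -normrM -innerZr -vM.
    apply: le_trans (inner_le_frob _ _) _.
    rewrite -[in leRHS]frob_sqr expr2 mulrA [leRHS]mulrC ler_wpM2l ?frob_ge0 //.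
    by rewrite mulrC frobM.
  by rewrite ler_norml => /andP[].
have [_ /(_ x)] := psdM.
by rewrite mulmxBl innerBr mul_scalar_mx innerZr subr_ge0.
Qed.

End SmallestEigenvalue.

(** * The bundle method *)

Section Lagrangian.
Variables (R : realType) (n m : nat).
Variables (C : 'M[R]_n) (A : {linear 'M[R]_n -> 'cV[R]_m}) (b : 'cV[R]_m).
Hypothesis symC : sym_mx C.

(** The Lagrangian, affine in [y]. Every cut is [lagr X] for some [X], and so is every finite
    aggregate, with [X] the primal iterate; this is how values of the model give information on the
    primal side. *)
Definition lagr (X : 'M[R]_n) (y : 'cV[R]_m) : R :=
  inner (A X - b) y - inner C X.

Lemma lagrE X y : sym_mx X ->
  lagr X y = inner (- b) y - inner (dual_slack C A y) X.
Proof.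
by move=> symX; rewrite /lagr /dual_slack !innerE adjointP // (innerC y); ring.
Qed.

Lemma sym_slack y : sym_mx (dual_slack C A y).
Proof. by rewrite /sym_mx linearB /= symC adjoint_sym. Qed.

Lemma psd_scalar_shift (M : 'M[R]_n) : sym_mx M ->
  psd (M - (lambda_min M)%:M).
Proof.
move=> symM; split; first by rewrite /sym_mx linearB /= symM tr_scalar_mx.
move=> x; rewrite mulmxBl innerBr mul_scalar_mx innerZr subr_ge0.
exact: lambda_min_le.
Qed.

(** For the slack M, pairing X with M - lambda_min(M) I gives <M, X> >= lambda_min(M) tr X, which is
    at least alpha min(lambda_min(M), 0). *)
Lemma lagr_le_penalized alpha X y : psd X -> \tr X <= alpha ->
  lagr X y <= penalized C A b alpha y.
Proof.
move=> psdX trX; have [symX _] := psdX.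
rewrite lagrE // /penalized lerB //.
set M := dual_slack C A y; have symM : sym_mx M by exact: sym_slack.
have trX0 : 0 <= \tr X.
  have [p [B ->]] := psd_factor psdX.
  by rewrite mxtrace_mulC; exact: inner_ge0.
have := psd_inner_ge0 (psd_scalar_shift symM) psdX.
have -> : inner (M - (lambda_min M)%:M) X = inner M X - lambda_min M * \tr X.
  by rewrite innerBl /inner tr_scalar_mx mul_scalar_mx mxtraceZ.
have : Num.min (lambda_min M) 0 <= lambda_min M by rewrite ge_min lexx.
have : Num.min (lambda_min M) 0 <= 0 by rewrite ge_min lexx orbT.
move: (Num.min (lambda_min M) 0) (lambda_min M) => u l u0 ul; nra.
Qed.

Lemma cut_vectorP (M : 'M[R]_n) (v : 'cV[R]_n) : cut_vector M v ->
  Num.min (lambda_min M) 0 = inner v (M *m v) /\ inner v v <= 1.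
Proof.
rewrite /cut_vector; case: ifPn => [l0 [Mv v1]|l0 ->].
  rewrite Mv innerZr -frob_sqr v1 expr1n mulr1; split=> //.
  by rewrite min_l.
rewrite mulmx0 inner0r ler01; split=> //.
by rewrite min_r // ltW // ltNge.
Qed.

Lemma inner_dyad (M : 'M[R]_n) (v : 'cV[R]_n) : inner M (v *m v^T) = inner v (M *m v).
Proof. by rewrite inner_mull trmxK innerC. Qed.

Lemma tr_dyad (v : 'cV[R]_n) : \tr (v *m v^T) = inner v v.
Proof. by rewrite mxtrace_mulC. Qed.

Lemma sym_scale_dyad a (v : 'cV[R]_n) : sym_mx (a *: (v *m v^T)).
Proof. by rewrite /sym_mx linearZ /= trmx_mul trmxK. Qed.

Lemma psdZ a (X : 'M[R]_n) : 0 <= a -> psd X -> psd (a *: X).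
Proof.
move=> a0 [symX posX]; split; first by rewrite /sym_mx linearZ /= symX.
by move=> x; rewrite -scalemxAl innerZr mulr_ge0.
Qed.

Lemma psdD (X Y : 'M[R]_n) : psd X -> psd Y -> psd (X + Y).
Proof.
move=> [symX posX] [symY posY]; split.
  by rewrite /sym_mx linearD /= symX symY.
by move=> x; rewrite mulmxDl innerDr addr_ge0.
Qed.

Lemma cutE alpha (s : trajectory R n m) t y :
  cut_vector (dual_slack C A (bz s t)) (bv s t) ->
  Defs.cut C A b alpha s t y = lagr (alpha *: (bv s t *m (bv s t)^T)) y.
Proof.
move=> /cut_vectorP[minE _]; rewrite /Defs.cut /penalized /cut_grad minE.
set v := bv s t; set z := bz s t.
have -> : inner (- b + alpha *: A (v *m v^T)) (y - z) =
    inner (- b) (y - z) + inner (A (alpha *: (v *m v^T))) (y - z).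
  by rewrite innerDl linearZ.
have symv := sym_scale_dyad alpha v.
rewrite -inner_dyad -innerZr; move: (alpha *: _) symv => W symW.
rewrite /dual_slack innerBl adjointP // /lagr !innerE (innerC z); ring.
Qed.

Lemma lagr_cvx th X Y y :
  lagr (th *: X + (1 - th) *: Y) y = th * lagr X y + (1 - th) * lagr Y y.
Proof. by rewrite /lagr linearD !linearZ /= !innerE; ring. Qed.

Lemma resid_cvx th X Y :
  A (th *: X + (1 - th) *: Y) - b = th *: (A X - b) + (1 - th) *: (A Y - b).
Proof.
rewrite linearD !linearZ /= !scalerBr addrACA; congr (_ + _).
by rewrite -opprD -scalerDl addrC subrK scale1r.
Qed.

Section Step.
Variables (rho : R) (y1 : 'cV[R]_m).
Hypothesis rho0 : 0 < rho.

(** The minimizer of the proximal objective whose minimum is [prox_val X]. *)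
Definition prox_point X := y1 - rho^-1 *: (A X - b).

(* The minimum over y of lagr X y + rho/2 |y - y1|^2. *)
Definition prox_val X := lagr X y1 - (rho^-1 / 2) * inner (A X - b) (A X - b).

Lemma lagr_prox_point X Y :
  lagr Y (prox_point X) = lagr Y y1 - rho^-1 * inner (A Y - b) (A X - b).
Proof. by rewrite /lagr /prox_point innerBr innerZr; ring. Qed.

Lemma prox_val_ge X : lagr X (prox_point X) <= prox_val X.
Proof.
rewrite lagr_prox_point /prox_val.
have := inner_ge0 (A X - b); have : 0 < rho^-1 by rewrite invr_gt0.
move: (inner _ _) rho^-1 => q i; nra.
Qed.

(** Along the segment from X to V the proximal value is an exact quadratic in [th]. For D >= 0 and q
    > 0 its maximizer over [0, 1] is min(1, rho D / q), the weight of the method. *)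
Lemma prox_val_step th X V (q := inner (A V - A X) (A V - A X))
    (D := lagr V (prox_point X) - lagr X (prox_point X)) :
  prox_val (th *: V + (1 - th) *: X) =
    prox_val X + th * D - th ^+ 2 * q * (rho^-1 / 2).
Proof.
have -> : q = inner ((A V - b) - (A X - b)) ((A V - b) - (A X - b)).
  by rewrite opprB addrA subrK.
rewrite /D !lagr_prox_point /prox_val lagr_cvx resid_cvx.
move: (A X - b) (A V - b) => h g; rewrite !innerE (innerC h g); field.
exact: lt0r_neq0.
Qed.

(** This gap is the derivative in [th] of the quadratic of [prox_val_step]: at an unconstrained
    maximizer the two pieces of the model agree. *)
Lemma lagr_gap_step th X V (q := inner (A V - A X) (A V - A X))
    (D := lagr V (prox_point X) - lagr X (prox_point X))
    (z := prox_point (th *: V + (1 - th) *: X)) :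
  lagr V z - lagr X z = D - th * q / rho.
Proof.
have -> : q = inner ((A V - b) - (A X - b)) ((A V - b) - (A X - b)).
  by rewrite opprB addrA subrK.
rewrite /D /z !lagr_prox_point resid_cvx.
move: (A X - b) (A V - b) => h g; rewrite !innerE (innerC h g); field; exact: lt0r_neq0.
Qed.

(** The optimality conditions for maximizing that quadratic over [0, 1]: the derivative is
    nonnegative, and zero unless [th = 1]. *)
Lemma weight_spec (q D th : R) : 0 <= q -> 0 <= D ->
  th = (if q == 0 then 1 else Num.min 1 (rho * D / q)) ->
  [/\ 0 <= th <= 1, th * q <= rho * D & (1 - th) * (rho * D - th * q) = 0].
Proof.
move=> q0 D0; case: eqP => [-> ->|/eqP qn0].
  by rewrite mulr0 subrr mul0r ler01 lexx; split=> //; rewrite mulr_ge0 // ltW.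
have qp : 0 < q by rewrite lt_def qn0.
case: (leP 1 (rho * D / q)) => H ->.
  by rewrite subrr mul0r ler01 lexx mul1r; split=> //; rewrite -[q]mul1r -ler_pdivlMr.
have th0 : 0 <= rho * D / q by rewrite divr_ge0 // mulr_ge0 // ltW.
by rewrite th0 (ltW H) mulfVK // subrr mulr0.
Qed.

(** The gain is at least th D / 2. If th = 1, then D >= e >= rho e^2 / G; otherwise th q = rho D and
    th D >= rho D^2 / G. *)
Lemma weight_gain (q D th G e : R) : 0 <= q -> 0 <= D ->
  0 <= th <= 1 -> th * q <= rho * D -> (1 - th) * (rho * D - th * q) = 0 ->
  0 < G -> q <= G -> 0 <= e -> e <= D -> rho * e <= G ->
  rho * e ^+ 2 / (2 * G) <= th * D - th ^+ 2 * q * (rho^-1 / 2).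
Proof.
move=> q0 D0 /andP[th0 th1] thq thD G0 qG e0 eD eG.
have thgain : th * D / 2 <= th * D - th ^+ 2 * q * (rho^-1 / 2).
  have -> : th ^+ 2 * q * (rho^-1 / 2) = th / 2 * ((th * q) / rho).
    by field; exact: lt0r_neq0.
  have : th * q / rho <= D by rewrite ler_pdivrMr // [leRHS]mulrC.
  move: (th * q / rho) => u; nra.
apply: le_trans thgain; rewrite ler_pdivrMr ?mulr_gt0 //.
have -> : th * D / 2 * (2 * G) = th * D * G by field.
move/eqP: thD; rewrite mulf_eq0 => /orP[/eqP th1E|/eqP thqE].
  have -> : th = 1 by lra.
  nra.
have : th * q <= th * G by rewrite ler_wpM2l.
have -> : th * q = rho * D by lra.
move=> H; apply: (@le_trans _ _ (rho * D * D)); last by nra.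
by rewrite expr2 -!mulrA ler_pM2l // ler_pM.
Qed.

End Step.
End Lagrangian.

(** * Aggregates of a run and its progress up to the first descent step *)

Section BundleRun.
Variables (R : realType) (n m : nat).
Variables (C : 'M[R]_n) (A : {linear 'M[R]_n -> 'cV[R]_m}) (b : 'cV[R]_m).
Hypothesis symC : sym_mx C.
Variables (alpha rho beta : R) (y1 : 'cV[R]_m) (s : trajectory R n m).
Hypotheses (alpha0 : 0 <= alpha) (rho0 : 0 < rho).
Hypothesis run : bundle_run C A b alpha rho beta y1 s.

Local Notation L := (lagr C A b).
Local Notation F := (penalized C A b alpha).
Local Notation prox_pt := (prox_point A b rho y1).
Local Notation val := (prox_val C A b rho y1).

Definition spectraplex : set 'M[R]_n := [set X | psd X /\ \tr X <= alpha].

Definition cut_mx t := alpha *: (bv s t *m (bv s t)^T).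

Lemma spectraplex_cvx th X Y : 0 <= th <= 1 -> spectraplex X -> spectraplex Y ->
  spectraplex (th *: X + (1 - th) *: Y).
Proof.
move=> /andP[th0 th1] [psdX trX] [psdY trY]; split.
  by apply: psdD; apply: psdZ => //; rewrite subr_ge0.
rewrite mxtraceD !mxtraceZ; nra.
Qed.

Lemma cut_mx_spectraplex t : (1 <= t)%N -> spectraplex (cut_mx t).
Proof.
move=> t1; split; first by apply: psdZ => //; exact: psd_gram.
have [_ v1] := cut_vectorP (run_v run t1).
by rewrite mxtraceZ tr_dyad -[leRHS]mulr1 ler_wpM2l.
Qed.

Lemma cut_gradE t : cut_grad A b alpha s t = A (cut_mx t) - b.
Proof. by rewrite /cut_grad /cut_mx linearZ addrC. Qed.

Lemma run_cut t y : (1 <= t)%N -> Defs.cut C A b alpha s t y = L (cut_mx t) y.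
Proof. by move=> t1; rewrite cutE //; exact: (run_v run). Qed.

Lemma penalized_bz t : (1 <= t)%N -> F (bz s t) = L (cut_mx t) (bz s t).
Proof. by move=> t1; rewrite -run_cut // /Defs.cut subrr inner0r addr0. Qed.

(** At t = 1 the aggregate is -oo and its gradient is arbitrary, so the identification with the
    Lagrangian of [bX s t] starts at 2. *)
Definition agg_inv t := spectraplex (bX s t) /\ ((2 <= t)%N ->
  (forall y, bagg s t y = (L (bX s t) y)%:E) /\ bgrad s t = A (bX s t) - b).

Let q t := inner (A (cut_mx t) - A (bX s t)) (A (cut_mx t) - A (bX s t)).
Let D t := L (cut_mx t) (bz s t) - L (bX s t) (bz s t).

Lemma theta1 : btheta s 1 = 1.
Proof. by rewrite (run_theta run). Qed.

Lemma theta_spec t : (2 <= t)%N -> agg_inv t ->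
  [/\ 0 <= btheta s t <= 1, btheta s t * q t <= rho * D t, 0 <= D t
    & (1 - btheta s t) * (rho * D t - btheta s t * q t) = 0].
Proof.
move=> t2 [[psdX trX] /(_ t2)[aggE gradE]]; have t1 : (1 <= t)%N by exact: ltnW.
have D0 : 0 <= D t by rewrite /D -penalized_bz // subr_ge0 lagr_le_penalized.
have q0 : 0 <= q t by exact: inner_ge0.
have tE : btheta s t = if q t == 0 then 1 else Num.min 1 (rho * D t / q t).
  rewrite (run_theta run) // /step_weight aggE gradE cut_gradE /=.
  have -> : A (cut_mx t) - b - (A (bX s t) - b) = A (cut_mx t) - A (bX s t).
    by rewrite opprB addrA subrK.
  rewrite frob_sqr (gtn_eqF t2) /=.
  have -> : (A (cut_mx t) - b == A (bX s t) - b) = (q t == 0).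
    apply/eqP/eqP => [/addIr E|/inner_eq0/eqP]; first by rewrite /q E subrr inner0r.
    by rewrite subr_eq0 => /eqP ->.
  by rewrite /D -penalized_bz.
by have [] := weight_spec rho0 q0 D0 tE.
Qed.

Lemma bX_step t : (1 <= t)%N ->
  bX s t.+1 = btheta s t *: cut_mx t + (1 - btheta s t) *: bX s t.
Proof. by move=> t1; rewrite (run_X run) // /cut_mx scalerA. Qed.

Lemma bX2 : bX s 2 = cut_mx 1.
Proof. by rewrite bX_step // theta1 subrr scale0r addr0 scale1r. Qed.

Lemma agg_invP t : (1 <= t)%N -> agg_inv t.
Proof.
elim: t => [//|[_ _|t IH _]].
  split=> //; rewrite (run_X1 run); split; last by rewrite mxtrace0.
  by split=> [|x]; [rewrite /sym_mx trmx0 | rewrite mul0mx inner0r].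
have {}IH := IH isT; have [splX aggt] := IH.
have [t0|t0] := posnP t.
  rewrite t0 in IH aggt splX *; split; first by rewrite bX2; exact: cut_mx_spectraplex.
  move=> _; rewrite bX2; split=> [y|].
    rewrite (run_agg run) // theta1 subrr mul0e adde0 mul1e run_cut //.
  by rewrite (run_grad run) // theta1 subrr scale0r addr0 scale1r cut_gradE.
have t2 : (2 <= t.+1)%N by rewrite ltnS.
have [th01 _ _ _] := theta_spec t2 IH; have [aggE gradE] := aggt t2.
split.
  rewrite bX_step //; apply: spectraplex_cvx => //.
  exact: cut_mx_spectraplex.
move=> _; rewrite bX_step //; split=> [y|].
  by rewrite (run_agg run) // aggE run_cut // lagr_cvx [RHS]EFinD !EFinM.
by rewrite (run_grad run) // gradE cut_gradE resid_cvx.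
Qed.

Lemma bz_step t : (1 <= t)%N -> by_ s t = y1 -> bz s t.+1 = prox_pt (bX s t.+1).
Proof.
move=> t1 yE; have [_ /(_ t1)[_ gradE]] := agg_invP (ltn0Sn t).
by rewrite (run_z run) // yE /prox_point -gradE (run_grad run).
Qed.

Section Rate.
Variables (dstar G : R) (T : nat).
Hypothesis betaE : beta = (1 + rho)^-1.
Hypothesis F_ge : forall y, dstar <= F y.
Hypothesis G0 : 0 < G.
Hypothesis G_diff : forall X Y, spectraplex X -> spectraplex Y ->
  inner (A X - A Y) (A X - A Y) <= G.
Hypothesis G_resid : forall X, spectraplex X -> inner (A X - b) (A X - b) <= G.
Hypotheses (T2 : (2 <= T)%N) (GT : 2 * G / rho ^+ 2 <= T%:R).

Let K := Num.max 1 (F y1 - dstar).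

Let good t := dstar - K * rho <= val (bX s t).

(* While the centre is y1, z_t is the proximal point of the aggregate, and then
   the weight theta_t is that of the exact proximal step: the model and the new
   aggregate agree at z_{t+1}. This fails after a descent step. *)
Lemma model_le_val t : (1 <= t)%N -> by_ s t = y1 ->
  (t = 1 \/ bz s t = prox_pt (bX s t)) ->
  exists2 mval, model C A b alpha s t (bz s t.+1) = mval%:E &
    mval <= val (bX s t.+1).
Proof.
move=> t1 yE ztE; rewrite /model run_cut //.
have zE := bz_step t1 yE.
have [tE|t2] : t = 1 \/ (2 <= t)%N by case: t t1 {yE ztE zE} => [|[|t]]; auto.
  exists (L (cut_mx t) (bz s t.+1)).
    by rewrite tE (run_agg1 run) maxeNy.
  by rewrite zE tE -bX2; exact: prox_val_ge.
have {ztE}zt : bz s t = prox_pt (bX s t).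
  by case: ztE => // tE; rewrite tE in t2.
have [splX aggt] := agg_invP t1; have [aggE gradE] := aggt t2.
have [th01 thq D0 thD] := theta_spec t2 (agg_invP t1).
rewrite aggE zE; set z := prox_pt _.
have gap := lagr_gap_step C A b y1 rho0 (btheta s t) (bX s t) (cut_mx t).
rewrite /= -bX_step // -/z -zt -/(D t) -/(q t) in gap.
have XV : L (bX s t) z <= L (cut_mx t) z.
  by rewrite -subr_ge0 gap subr_ge0 ler_pdivrMr // [leRHS]mulrC.
exists (L (cut_mx t) z).
  by apply/max_idPl; rewrite lee_fin.
suff -> : L (cut_mx t) z = L (bX s t.+1) z by exact: prox_val_ge.
rewrite [in RHS]bX_step // lagr_cvx.
have : (1 - btheta s t) * (L (cut_mx t) z - L (bX s t) z) = 0.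
  rewrite gap; apply: (mulfI (lt0r_neq0 rho0)); rewrite mulr0 -[RHS]thD.
  by field; exact: lt0r_neq0.
lra.
Qed.

Let descent_arith (r k u v d mval : R) :
  (1 + r) * v <= (1 + r) * u - (u - mval) -> (1 + r) * d <= (1 + r) * v ->
  (u - d) * r <= k * r -> d - k * r <= mval.
Proof. lra. Qed.

(* As beta = 1/(1 + rho), a descent step forces the model value at the trial point
   to be at least dstar - rho (F y1 - dstar). *)
Lemma descent_good t : (1 <= t)%N -> by_ s t = y1 ->
  (t = 1 \/ bz s t = prox_pt (bX s t)) ->
  descent_test C A b alpha beta s t -> good t.+1.
Proof.
move=> t1 yE ztE; have [mval mE mle] := model_le_val t1 yE ztE.
rewrite /descent_test mE yE -(EFinB (F y1) mval) -EFinM -EFinB lee_fin betaE => H.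
apply: le_trans mle.
have Fz := F_ge (bz s t.+1).
have : (1 + rho) * F (bz s t.+1) <= (1 + rho) * F y1 - (F y1 - mval).
  rewrite -ler_pdivlMl ?addr_gt0 // (le_trans H) // [leRHS]mulrBr mulKf //.
  by rewrite gt_eqF // addr_gt0.
move=> /descent_arith; apply; first by rewrite ler_pM2l // addr_gt0.
by rewrite ler_pM2r // le_max lexx orbT.
Qed.

(** The new cut has value F(z_t) >= dstar at z_t, and the aggregate has value at most [val (bX s t)]
    there, so [D t] dominates the gap and [weight_gain] applies. *)
Lemma null_gain t : (2 <= t)%N -> bz s t = prox_pt (bX s t) ->
  0 <= dstar - val (bX s t) -> rho * (dstar - val (bX s t)) <= G ->
  dstar - val (bX s t.+1) <=
    dstar - val (bX s t) - rho * (dstar - val (bX s t)) ^+ 2 / (2 * G).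
Proof.
move=> t2 zt e0 eG; have t1 : (1 <= t)%N by exact: ltnW.
have [splX aggt] := agg_invP t1; have [aggE gradE] := aggt t2.
have [th01 thq D0 thD] := theta_spec t2 (agg_invP t1).
have := prox_val_step C A b y1 rho0 (btheta s t) (bX s t) (cut_mx t).
rewrite /= -bX_step // -zt -/(D t) -/(q t) => ->.
have eD : dstar - val (bX s t) <= D t.
  rewrite /D -penalized_bz // lerB //; last by rewrite zt prox_val_ge.
have := weight_gain rho0 (inner_ge0 _) D0 th01 thq thD G0 _ e0 eD eG.
rewrite -/(q t) => /(_ (G_diff (cut_mx_spectraplex t1) splX)); lra.
Qed.

(** As x - x^2 increases on [0, 1/2], x may be replaced by 1/t; then (1/t - 1/t^2)(t + 1) = 1 -
    1/t^2. *)
Lemma rate_rec (x : R) (t : nat) : (2 <= t)%N -> 0 <= x -> x <= t%:R^-1 ->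
  x - x ^+ 2 <= (t.+1)%:R^-1.
Proof.
move=> t2 x0 xt; have tp : 2 <= t%:R :> R by rewrite ler_nat.
have tp0 : 0 < t%:R :> R by lra.
have i0 : 0 < t%:R^-1 :> R by rewrite invr_gt0.
apply: (@le_trans _ _ (t%:R^-1 - t%:R^-1 ^+ 2)).
  have : t%:R^-1 <= 2^-1 :> R by rewrite lef_pV2 ?posrE.
  move: (t%:R^-1) xt i0 => i; nra.
rewrite -natr1 -[leRHS]mul1r ler_pdivlMr; last lra.
have -> : (t%:R^-1 - t%:R^-1 ^+ 2) * (t%:R + 1) = 1 - t%:R^-1 ^+ 2 :> R.
  by field; rewrite gt_eqF.
by rewrite gerBl sqr_ge0.
Qed.

(** The scaled gap x = rho e / (2 G) obeys x' <= x - x^2 along null steps, so [rate_rec] propagates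
    x <= 1/t. *)
Lemma run_progress t : (2 <= t)%N ->
  (exists2 t', (2 <= t' <= t)%N & good t') \/
  [/\ by_ s t = y1, bz s t = prox_pt (bX s t) &
    rho * (dstar - val (bX s t)) / (2 * G) <= t%:R^-1].
Proof.
have G2 : 0 < 2 * G by rewrite mulr_gt0.
elim: t => [//|t IH]; rewrite ltnS leq_eqVlt => /orP[/eqP <-|t2].
  have [desc|null] := pselect (descent_test C A b alpha beta s 1).
    by left; exists 2 => //; apply: descent_good => //; [exact: run_y1 run|left].
  right; split; first by rewrite (run_null run) // (run_y1 run).
    by rewrite bz_step // (run_y1 run).
  rewrite ler_pdivrMr // bX2 /prox_val.
  have := G_resid (cut_mx_spectraplex (leqnn 1)).
  have := F_ge y1; rewrite -(run_z1 run) penalized_bz // (run_z1 run).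
  move: (inner _ _) (L _ _) => r l Fl rG.
  have -> : rho * (dstar - (l - rho^-1 / 2 * r)) = rho * (dstar - l) + r / 2.
    by field; exact: lt0r_neq0.
  have : rho * (dstar - l) <= 0 by rewrite pmulr_rle0 // subr_le0.
  have -> : 2^-1 * (2 * G) = G by field.
  lra.
have [[t' /andP[t'2 t't] gt']|[yE zt et]] := IH t2.
  by left; exists t' => //; rewrite t'2 leqW.
have t1 : (1 <= t)%N by exact: ltnW.
have [desc|null] := pselect (descent_test C A b alpha beta s t).
  by left; exists t.+1; [rewrite ltnS t1 /=|apply: descent_good => //; right].
have [e0|e0] := leP (dstar - val (bX s t)) 0.
  left; exists t; first by rewrite t2 leqnSn.
  have : 0 <= K * rho by rewrite mulr_ge0 ?le_max ?ler01 // ltW.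
  by rewrite /good; move: (K * rho) e0 => K'; lra.
right; split; first by rewrite (run_null run).
  by rewrite bz_step.
set e := dstar - val (bX s t) in e0 et *.
have eG : rho * e <= G.
  have : rho * e / (2 * G) <= 2^-1.
    by rewrite (le_trans et) // lef_pV2 ?posrE ?ltr0n // ler_nat.
  rewrite ler_pdivrMr //; lra.
have := null_gain t2 zt (ltW e0) eG; rewrite -/e => gain.
apply: le_trans (rate_rec t2 _ et); last first.
  by rewrite divr_ge0 ?mulr_ge0 // ltW.
have -> : rho * e / (2 * G) - (rho * e / (2 * G)) ^+ 2 =
    rho * (e - rho * e ^+ 2 / (2 * G)) / (2 * G) by field; rewrite gt_eqF.
by rewrite ler_pM2r ?invr_gt0 // ler_pM2l.
Qed.

Lemma run_good : exists2 t, (2 <= t <= T)%N & good t.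
Proof.
have [//|[_ _ eT]] := run_progress T2; exists T; first by rewrite T2 leqnn.
have T0 : 0 < T%:R :> R by rewrite ltr0n (leq_trans _ T2).
have : dstar - val (bX s T) <= rho.
  move: eT GT; rewrite ler_pdivrMr ?mulr_gt0 // ler_pdivrMr ?exprn_gt0 // => eT GT'.
  have {}eT : T%:R * (rho * (dstar - val (bX s T))) <= 2 * G.
    by rewrite -ler_pdivlMl.
  have : T%:R * (rho * (dstar - val (bX s T))) <= T%:R * (rho * rho).
    by rewrite (le_trans eT) // -expr2.
  by rewrite ler_pM2l // ler_pM2l.
have : 1 * rho <= K * rho by rewrite ler_pM2r // le_max lexx.
by rewrite /good; move: (K * rho) => K'; lra.
Qed.

End Rate.
End BundleRun.

(** * From the proximal value to primal residuals *)

Section BundleOutput.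
Variables (R : realType) (n m : nat).
Variables (C : 'M[R]_n) (A : {linear 'M[R]_n -> 'cV[R]_m}) (b : 'cV[R]_m).
Hypothesis symC : sym_mx C.

Lemma frob_spectraplex alpha (X : 'M[R]_n) : spectraplex alpha X -> frob X <= alpha.
Proof.
move=> [/psd_factor[p [B ->]] trX]; apply: le_trans (frobM _ _) _.
by rewrite frob_trmx -expr2 frob_sqr /inner mxtrace_mulC.
Qed.

Let quadratic_bound (k w u : R) : 1 <= k -> 0 <= w -> 0 <= u ->
  u ^+ 2 <= 2 * k + 2 * w * u -> u <= 2 * k + 2 * w.
Proof.
move=> k1 w0 u0 H; rewrite leNgt; apply/negP => ku; nra.
Qed.

Let scaled_bound (rho k w h : R) : 0 < rho -> 1 <= k -> 0 <= w -> 0 <= h ->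
  rho^-1 / 2 * h ^+ 2 <= k * rho + h * w -> h <= (2 * k + 2 * w) * rho.
Proof.
move=> rho0 k1 w0 h0 H; rewrite -ler_pdivrMr //.
apply: quadratic_bound => //; first by rewrite divr_ge0 // ltW.
have -> : (h / rho) ^+ 2 = (rho^-1 / 2 * h ^+ 2) * (2 / rho).
  by field; exact: lt0r_neq0.
have -> : 2 * k + 2 * w * (h / rho) = (k * rho + h * w) * (2 / rho).
  by field; exact: lt0r_neq0.
by rewrite ler_pM2r // divr_gt0.
Qed.

(** Let h = |A X - b| and let S be the slack at [ystar]. The Lagrangian at [ystar] equals dstar -
    <S, X> and differs from that at [y1] by at most h w. Hence <S, X> + h^2 / (2 rho) <= k rho + h
    w, and both terms on the left are nonnegative. *)
Lemma prox_val_output (rho k : R) (y1 ystar : 'cV[R]_m) (X : 'M[R]_n)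
    (w := frob (ystar - y1)) (dstar := inner (- b) ystar) :
  0 < rho -> 1 <= k -> psd X -> psd (dual_slack C A ystar) ->
  dstar - k * rho <= prox_val C A b rho y1 X ->
  frob (A X - b) <= (2 * k + 2 * w) * rho /\
  inner (dual_slack C A ystar) X <= (k + (2 * k + 2 * w) * w) * rho.
Proof.
move=> rho0 k1 psdX psdS; rewrite /prox_val -frob_sqr => Hval.
have SX := psd_inner_ge0 psdS psdX.
have symX : sym_mx X by case: psdX.
have := lagrE C A b ystar symX; rewrite -/dstar => LE.
have LE2 : lagr C A b X ystar = lagr C A b X y1 + inner (A X - b) (ystar - y1).
  by rewrite /lagr innerBr; ring.
have := inner_le_frob (A X - b) (ystar - y1); rewrite -/w.
rewrite ler_norml => /andP[inl inu].
have h0 := frob_ge0 (A X - b); have w0 : 0 <= w by exact: frob_ge0.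
move: (inner (A X - b) _) (lagr C A b X y1) (lagr C A b X ystar) (inner _ X)
  (frob (A X - b)) w w0 h0 inl inu LE LE2 SX Hval =>
  i l1 l2 sx h w w0 h0 inl inu LE LE2 SX Hval.
have hb : h <= (2 * k + 2 * w) * rho.
  by apply: scaled_bound => //; lra.
split=> //.
have : h * w <= (2 * k + 2 * w) * rho * w by rewrite ler_wpM2r.
have : 0 <= rho^-1 / 2 * h ^+ 2.
  by rewrite mulr_ge0 ?sqr_ge0 // divr_ge0 // invr_ge0 ltW.
move: (rho^-1 / 2 * h ^+ 2) Hval => c Hval c0; lra.
Qed.

Lemma bundle_converges (y1 ystar : 'cV[R]_m) (Xstar : 'M[R]_n) :
  primal_feasible A b Xstar -> psd (dual_slack C A ystar) ->
  inner (- C) Xstar = inner (- b) ystar ->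
  exists alpha K, [/\ 0 < alpha, 0 < K &
    forall (rho : R) (T : nat), 0 < rho -> (2 <= T)%N -> K / rho ^+ 2 <= T%:R ->
    forall s, bundle_run C A b alpha rho (1 + rho)^-1 y1 s ->
    exists2 t, (2 <= t <= T)%N &
      [/\ spectraplex alpha (bX s t), frob (A (bX s t) - b) <= K * rho &
        inner (dual_slack C A ystar) (bX s t) <= K * rho]].
Proof.
move=> [symXs AXs psdXs] psdS gap; set dstar := inner (- b) ystar in gap.
have trXs : 0 <= \tr Xstar.
  have [p [B ->]] := psd_factor psdXs.
  by rewrite mxtrace_mulC; exact: inner_ge0.
pose alpha := 1 + \tr Xstar; have alpha0 : 0 < alpha by rewrite /alpha; lra.
have F_ge y : dstar <= penalized C A b alpha y.
  have <- : lagr C A b Xstar y = dstar.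
    by rewrite /lagr AXs subrr innerC inner0r sub0r -innerNl.
  by apply: lagr_le_penalized => //; rewrite /alpha lerDr.
have [KA KA0 KAP] := linear_frob_le A.
(* [g] bounds both |A X - A Y| and |A X - b| on the spectraplex; the 1 makes it positive. *)
pose g := 2 * (KA * alpha) + frob b + 1.
have g0 : 0 < g by rewrite /g ltr_wpDl // addr_ge0 ?frob_ge0 // !mulr_ge0 // ltW.
have AX_le X : spectraplex alpha X -> frob (A X) <= KA * alpha.
  by move=> /frob_spectraplex ?; rewrite (le_trans (KAP _)) // ler_wpM2l.
have KAa0 : 0 <= KA * alpha by rewrite mulr_ge0 // ltW.
have b0 := frob_ge0 b.
have sqr_le (v : 'cV[R]_m) : frob v <= g -> inner v v <= g ^+ 2.
  by move=> vg; rewrite -frob_sqr lerXn2r // nnegrE ?frob_ge0 // ltW.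
pose k := Num.max 1 (penalized C A b alpha y1 - dstar).
have k1 : 1 <= k by rewrite le_max lexx.
pose w := frob (ystar - y1); have w0 : 0 <= w by exact: frob_ge0.
pose K1 := 2 * k + 2 * w; pose K2 := k + K1 * w.
have K10 : 0 < K1 by rewrite /K1; lra.
have K20 : 0 < K2 by rewrite /K2 ltr_wpDr ?mulr_ge0 ?(ltW K10) //; lra.
have G0 : 0 < g ^+ 2 by rewrite exprn_gt0.
exists alpha, (K1 + K2 + 2 * g ^+ 2); split=> //; first lra.
move=> rho T rho0 T2 KT s run.
have GT : 2 * g ^+ 2 / rho ^+ 2 <= T%:R.
  apply: le_trans KT; rewrite ler_pM2r ?invr_gt0 ?exprn_gt0 //; lra.
have [X Y sX sY|X sX|t tT good] :=
  run_good symC (ltW alpha0) rho0 run erefl F_ge G0 _ _ T2 GT.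
- apply: sqr_le; rewrite (le_trans (frobB _ _)) //.
  have := AX_le _ sX; have := AX_le _ sY; rewrite /g; lra.
- apply: sqr_le; rewrite (le_trans (frobB _ _)) //.
  have := AX_le _ sX; rewrite /g; lra.
exists t => //; have t1 : (1 <= t)%N by case/andP: tT => /ltnW.
have [splX _] := agg_invP symC (ltW alpha0) rho0 run t1.
have [psdX _] := splX.
have [h1 h2] := prox_val_output rho0 k1 psdX psdS good.
split=> //.
- by rewrite (le_trans h1) // ler_pM2r // -/w -/K1; lra.
- by rewrite (le_trans h2) // ler_pM2r // -/w -/K1 -/K2; lra.
Qed.

End BundleOutput.

(** * Quadratic growth under strict complementarity *)

Section Growth.
Variable R : realType.

Lemma psd_congr n p (X : 'M[R]_n) (M : 'M[R]_(p, n)) :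
  psd X -> psd (M *m X *m M^T).
Proof.
by move=> /psd_factor[q [B ->]]; rewrite mulmxA -mulmxA -trmx_mul; exact: psd_gram.
Qed.

Lemma psd_inner_eq0 n (X Y : 'M[R]_n) :
  psd X -> psd Y -> inner Y X = 0 -> Y *m X = 0.
Proof.
move=> /psd_factor[p [B ->]] /psd_factor[q [D ->]].
rewrite inner_mull trmxK innerC -mulmxA inner_mulr => /inner_eq0 DB0.
by rewrite mulmxA -(mulmxA D) DB0 mulmx0 mul0mx.
Qed.

Lemma gram_unit n p (K : 'M[R]_(p, n)) : row_free K -> K *m K^T \in unitmx.
Proof.
move=> freeK; rewrite -row_free_unit -kermx_eq0; apply/rowV0P => v /sub_kermxP.
rewrite mulmxA => vKK; apply: (row_free_inj freeK); rewrite mul0mx.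
by apply: inner_eq0; rewrite inner_mull vKK innerC inner0r.
Qed.

(** A generalized inverse h satisfies f h f = f, and N1 = N0 - h (f N0 - f N). The matrix N
    certifies that the target value lies in the range of f. *)
Lemma linear_section m p q (f : {linear 'M[R]_(p, q) -> 'cV[R]_m}) :
  exists2 K, 0 <= K & forall N0 N, exists2 N1, f N1 = f N &
    frob (N1 - N0) <= K * frob (f N0 - f N).
Proof.
pose g := pinvmx (lin_mx f).
pose h := vec_mx \o mulmxr g \o (@mxvec R m 1) : {linear 'cV[R]_m -> 'M[R]_(p, q)}.
have [K K0 KP] := linear_frob_le h.
exists K => // N0 N; exists (N0 - h (f N0 - f N)); last first.
  by rewrite addrAC subrr sub0r frobN KP.
have fh M : f (h (f M)) = f M.
  apply: (can_inj mxvecK); rewrite -(mul_vec_lin f) /h /= vec_mxK.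
  by rewrite -mul_vec_lin mulmxKpV // submxMl.
by rewrite -linearB [LHS]linearB fh linearB subKr.
Qed.

Section StrictComplementarity.
Variables (n m : nat).
Variables (C : 'M[R]_n) (A : {linear 'M[R]_n -> 'cV[R]_m}) (b : 'cV[R]_m).
Variables (Xs : 'M[R]_n) (ys : 'cV[R]_m).
Let S := dual_slack C A ys.
Hypotheses (feasXs : primal_feasible A b Xs) (psdS : psd S).
Hypothesis gap : inner (- C) Xs = inner (- b) ys.
Hypothesis rankXS : (\rank Xs + \rank S = n)%N.

Lemma primal_value X : primal_feasible A b X ->
  inner (- C) X = inner (- b) ys - inner S X.
Proof.
move=> [symX AX _]; rewrite /S /dual_slack innerBl adjointP // AX !innerNl.
by rewrite (innerC ys) opprB addrA addNr sub0r.
Qed.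

Lemma slack_optimal X : primal_feasible A b X -> inner S X = 0 ->
  primal_sol C A b X.
Proof.
move=> feasX SX0; split=> // Y feasY; rewrite !primal_value // SX0 subr0.
by rewrite gerBl psd_inner_ge0 //; case: feasY.
Qed.

Local Notation r := (\rank Xs).
Variable K : 'M[R]_(r, n).
Hypothesis KXs : (K :=: Xs)%MS.
Let W := K^T.
Let G := invmx (K *m K^T) *m K.
Let P := W *m G.

Let freeK : row_free K.
Proof. by rewrite /row_free KXs. Qed.

Let GW : G *m W = 1%:M.
Proof. by rewrite -mulmxA mulVmx // gram_unit. Qed.

Let SXs0 : S *m Xs = 0.
Proof.
apply: psd_inner_eq0 => //; first by case: feasXs.
have := primal_value feasXs; rewrite gap; lra.
Qed.

Let SW : S *m W = 0.
Proof.
have symS : S^T = S by case: psdS.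
have symXs : Xs^T = Xs by case: feasXs.
apply: trmx_inj; rewrite trmx_mul trmxK trmx0 symS.
have /submxP[E ->] : (K <= Xs)%MS by rewrite KXs.
by rewrite -mulmxA -[Xs *m S]trmxK trmx_mul symS symXs SXs0 trmx0 mulmx0.
Qed.

Let symP : P^T = P.
Proof.
have : (invmx (K *m K^T))^T = invmx (K *m K^T).
  by rewrite trmx_inv trmx_mul trmxK.
rewrite /P /G /W; move: (invmx _) => J symJ.
by rewrite !trmx_mul trmxK symJ mulmxA.
Qed.

(** Strict complementarity enters here. From S (1 - P) = S the row space of S lies in that of 1 - P,
    and (1 - P) W = 0 bounds the rank of 1 - P by n - rank Xs = rank S, so the row spaces
    coincide. *)
Let factorP : exists H, 1%:M - P = H *m S.
Proof.
apply/submxP.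
have sub : (S <= 1%:M - P)%MS.
  apply/submxP; exists S.
  by rewrite mulmxBr mulmx1 /P mulmxA SW mul0mx subr0.
rewrite -(mxrank_leqif_sup sub) eqn_leq (mxrankS sub) /=.
have : (1%:M - P) *m W = 0 by rewrite mulmxBl mul1mx -mulmxA GW mulmx1 subrr.
move=> /mulmx0_rank_max; rewrite mxrank_tr (eqnP freeK).
by move: rankXS; lia.
Qed.

Let PXs : P *m Xs = Xs.
Proof.
have [H HE] := factorP; apply/eqP; rewrite eq_sym -subr_eq0.
by rewrite -{1}[Xs]mul1mx -mulmxBl HE -mulmxA SXs0 mulmx0.
Qed.

Let Ns := G *m Xs *m G^T.

Let NsE : W *m Ns *m W^T = Xs.
Proof.
transitivity (P *m Xs *m P^T); first by rewrite /Ns /P (trmx_mul W G) !mulmxA.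
rewrite PXs symP; apply: trmx_inj; rewrite trmx_mul symP.
by case: feasXs => -> _ _.
Qed.

(** W Ns W^T = Xs has rank r, so the r x r matrix Ns is invertible, hence positive definite. *)
Let Ns_lower : exists2 k, 0 < k &
  forall x : 'cV[R]_r, k * inner x x <= inner x (Ns *m x).
Proof.
apply: psd_unit_lower; first by apply: psd_congr; case: feasXs.
rewrite -row_free_unit /row_free eqn_leq rank_leq_row /=.
rewrite -[X in (X <= _)%N](congr1 (@mxrank _ _ _) NsE).
by rewrite (leq_trans (mxrankM_maxl _ _)) // mxrankM_maxr.
Qed.

Let symmetrize (N : 'M[R]_r) := 2^-1 *: (N + N^T).

Let symmetrize_id N : sym_mx N -> symmetrize N = N.
Proof.
move=> symN; rewrite /symmetrize symN.
by apply/matrixP => i j; rewrite !mxE; field.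
Qed.

(** Symmetrizing lets [linear_section] work on all r x r matrices while A is evaluated at symmetric
    ones only. *)
Let face_map N := A (W *m symmetrize N *m W^T).

Let face_map_linear : linear face_map.
Proof.
move=> a M N; rewrite /face_map.
have -> : symmetrize (a *: M + N) = a *: symmetrize M + symmetrize N.
  by apply/matrixP => i j; rewrite !mxE; ring.
by rewrite mulmxDr mulmxDl -scalemxAr -scalemxAl linearD linearZ.
Qed.

HB.instance Definition _ :=
  GRing.isLinear.Build R _ _ _ face_map face_map_linear.

Lemma face_error_bound : exists2 c, 0 <= c & forall N0, sym_mx N0 ->
  exists N1, [/\ sym_mx N1, A (W *m N1 *m W^T) = b &
    frob (N1 - N0) <= c * frob (A (W *m N0 *m W^T) - b)].
Proof.
have [c c0 cP] := linear_section (face_map : {linear _ -> _}).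
exists c => // N0 symN0; have [N1 N1E N1N0] := cP N0 Ns.
have symNs : sym_mx Ns by case: (psd_congr G (let: And3 _ _ h := feasXs in h)).
have fNs : face_map Ns = b.
  by rewrite /face_map symmetrize_id // NsE; case: feasXs.
exists (symmetrize N1); split.
- by rewrite /sym_mx /symmetrize linearZ linearD /= trmxK addrC.
- exact: etrans N1E fNs.
have {}N1N0 : frob (N1 - N0) <= c * frob (face_map N0 - b).
  by rewrite -fNs; exact: N1N0.
move: N1N0; rewrite /face_map symmetrize_id // => N1N0.
apply: le_trans N1N0.
have -> : symmetrize N1 - N0 = 2^-1 *: ((N1 - N0) + (N1 - N0)^T).
  rewrite -{1}[N0]symmetrize_id // /symmetrize.
  by apply/matrixP => i j; rewrite !mxE; ring.
rewrite frobZ ger0_norm ?invr_ge0 // ler_pdivrMl //.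
by rewrite (le_trans (frobD _ _)) // frob_trmx; lra.
Qed.

(* P is the orthogonal projection on ker S, so that 1 - P = H S. If X = B B^T and
   S = D D^T, then <S, X> = |D^T B|^2 and (1 - P) B = H D (D^T B). *)
Let residual_bound : exists2 c, 0 <= c & forall alpha d (X : 'M[R]_n),
  0 <= d -> spectraplex alpha X -> inner S X <= d ^+ 2 ->
  frob (X - P *m X *m P) <= c * (alpha + 1) * d.
Proof.
have [H HE] := factorP; have [q [D SE]] := psd_factor psdS.
exists (frob (H *m D) * (1 + frob P)).
  by rewrite mulr_ge0 ?addr_ge0 ?frob_ge0.
move=> alpha d X d0 [/psd_factor[p [B ->]] trB] SX.
have alpha0 : 0 <= alpha.
  by apply: le_trans trB; rewrite mxtrace_mulC; exact: inner_ge0.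
(* |B|^2 = tr X <= alpha <= (alpha + 1)^2, which avoids a square root. *)
have B_le : frob B <= alpha + 1.
  apply: frob_le; first by rewrite addr_ge0.
  by rewrite /inner mxtrace_mulC (le_trans trB) //; nra.
have QB_le : frob ((1%:M - P) *m B) <= frob (H *m D) * d.
  have -> : (1%:M - P) *m B = (H *m D) *m (D^T *m B) by rewrite HE SE !mulmxA.
  apply: frobM_le => //; apply: frob_le => //; apply: le_trans SX.
  by rewrite SE [leRHS]inner_mull trmxK [leRHS]innerC -mulmxA [leRHS]inner_mulr.
have -> : B *m B^T - P *m (B *m B^T) *m P =
    ((1%:M - P) *m B) *m B^T + P *m (B *m ((1%:M - P) *m B)^T).
  rewrite trmx_mul linearB /= trmx1 symP !mulmxBl !mulmxBr mul1mx mulmx1.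
  by rewrite !mulmxA addrA subrK.
rewrite (le_trans (frobD _ _)) //.
have h1 : frob ((1%:M - P) *m B *m B^T) <= frob (H *m D) * d * (alpha + 1).
  by apply: frobM_le => //; rewrite frob_trmx.
have h2 : frob (P *m (B *m ((1%:M - P) *m B)^T)) <=
    frob P * ((alpha + 1) * (frob (H *m D) * d)).
  by apply: frobM_le => //; apply: frobM_le => //; rewrite frob_trmx.
apply: le_trans (lerD h1 h2) _.
rewrite [leRHS](_ : _ = frob (H *m D) * d * (alpha + 1) +
    frob P * ((alpha + 1) * (frob (H *m D) * d))) //.
ring.
Qed.

(* P X P is corrected linearly to meet the equality constraints, and then moved
   towards the positive definite Ns to become positive semidefinite again. *)
Lemma growth alpha : 0 <= alpha -> exists2 c, 0 <= c &
  forall (X : 'M[R]_n) d, 0 <= d -> d <= 1 -> spectraplex alpha X ->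
  frob (A X - b) <= d ^+ 2 -> inner S X <= d ^+ 2 ->
  exists N, primal_sol C A b (W *m N *m W^T) /\
    frob (X - W *m N *m W^T) <= c * d.
Proof.
move=> alpha0.
have [c1 c10 resid] := residual_bound; have [KA KA0 KAP] := linear_frob_le A.
have [c2 c20 face] := face_error_bound; have [k k0 kP] := Ns_lower.
set e1 := c1 * (alpha + 1); have e10 : 0 <= e1 by rewrite mulr_ge0 // addr_ge0.
set e2 := c2 * (KA * e1 + 1).
have e20 : 0 <= e2 by rewrite mulr_ge0 // addr_ge0 // mulr_ge0.
set e3 := e2 / k * (frob Ns + (frob G * alpha * frob G + e2)).
have e30 : 0 <= e3.
  apply: mulr_ge0; first by rewrite divr_ge0 // ltW.
  by rewrite !addr_ge0 ?frob_ge0 // !mulr_ge0 ?frob_ge0.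
exists (e1 + frob W * (e2 + e3) * frob W).
  by rewrite addr_ge0 // !mulr_ge0 ?frob_ge0 // addr_ge0.
move=> X d d0 d1 splX AX SX; have [psdX trX] := splX.
have dd : d ^+ 2 <= d by rewrite expr2 ler_piMl.
have X1 := resid _ _ _ d0 splX SX; rewrite -/e1 in X1.
pose N0 := G *m X *m G^T.
have psdN0 : psd N0 by exact: psd_congr.
have WN0 : W *m N0 *m W^T = P *m X *m P.
  transitivity (P *m X *m P^T); last by rewrite symP.
  by rewrite /N0 /P (trmx_mul W G) !mulmxA.
have [N1 [symN1 AN1 N1N0]] := face _ (proj1 psdN0).
have {}N1N0 : frob (N1 - N0) <= e2 * d.
  apply: le_trans N1N0 _; rewrite /e2 -mulrA ler_wpM2l // WN0.
  have -> : A (P *m X *m P) - b = (A X - b) - A (X - P *m X *m P).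
    by rewrite linearB; apply/matrixP => i j; rewrite !mxE; ring.
  rewrite (le_trans (frobB _ _)) //.
  have : KA * frob (X - P *m X *m P) <= KA * (e1 * d) by rewrite ler_wpM2l.
  have := KAP (X - P *m X *m P); lra.
(* The weight solves s k = (1 - s) tau: the positive part of Ns just compensates an eigenvalue of N1
   as low as -tau. *)
pose tau := e2 * d; pose s := tau / (tau + k).
have tau0 : 0 <= tau by rewrite mulr_ge0.
have tk : 0 < tau + k by rewrite ltr_wpDl.
have s0 : 0 <= s by rewrite divr_ge0 // ltW.
have s1 : s <= 1 by rewrite ler_pdivrMr // mul1r lerDl ltW.
have symNs : sym_mx Ns by apply: (proj1 (psd_congr G _)); case: feasXs.
pose N2 := s *: Ns + (1 - s) *: N1.
have psdN2 : psd N2.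
  split; first by rewrite /sym_mx /N2 linearD !linearZ /= symNs symN1.
  move=> x; rewrite /N2 mulmxDl -!scalemxAl innerDr !innerZr.
  have lower1 : - tau * inner x x <= inner x (N1 *m x).
    have -> : inner x (N1 *m x) = inner x (N0 *m x) + inner x ((N1 - N0) *m x).
      by rewrite mulmxBl innerBr addrC subrK.
    have := quad_le (N1 - N0) x; rewrite ler_norml => /andP[h _].
    rewrite -[leLHS]add0r lerD //; first exact: (proj2 psdN0).
    by apply: le_trans h; rewrite mulNr lerN2 ler_wpM2r // inner_ge0.
  have h1 : s * (k * inner x x) <= s * inner x (Ns *m x) by rewrite ler_wpM2l.
  have h2 : (1 - s) * (- tau * inner x x) <= (1 - s) * inner x (N1 *m x).
    by rewrite ler_wpM2l // subr_ge0.
  apply: le_trans (lerD h1 h2).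
  have -> : s * (k * inner x x) + (1 - s) * (- tau * inner x x) = 0; last by [].
  by rewrite /s; field; rewrite gt_eqF.
exists N2; split.
  have feas : primal_feasible A b (W *m N2 *m W^T).
    have psdW := psd_congr W psdN2; split=> //; first by case: psdW.
    have AD a c X1' X2' : A (a *: X1' + c *: X2') = a *: A X1' + c *: A X2'.
      by rewrite linearD !linearZ.
    rewrite /N2 mulmxDr mulmxDl -!scalemxAr -!scalemxAl AD.
    rewrite AN1 NsE; case: feasXs => _ -> _.
    by rewrite -scalerDl (_ : s + (1 - s) = 1) ?scale1r //; ring.
  (* S W = 0, so a feasible point of the form W N W^T is optimal. *)
  apply: slack_optimal => //.
  by rewrite inner_mull trmxK SW innerC inner0r.
have N0_le : frob N0 <= frob G * alpha * frob G.
  apply: frobM_le; last by rewrite frob_trmx.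
  by apply: frobM_le => //; exact: frob_spectraplex.
have tau_le : tau <= e2 by rewrite /tau ler_piMr.
have N21 : frob (N2 - N1) <= e3 * d.
  have -> : N2 - N1 = s *: (Ns - N1).
    by apply/matrixP => i j; rewrite !mxE; ring.
  rewrite frobZ ger0_norm //.
  have -> : e3 * d = (tau / k) * (frob Ns + (frob G * alpha * frob G + e2)).
    by rewrite /e3 /tau; ring.
  apply: ler_pM; rewrite ?frob_ge0 //.
    by rewrite /s ler_wpM2l // lef_pV2 ?posrE // lerDr.
  rewrite (le_trans (frobB _ _)) // lerD2l.
  have := frobD N0 (N1 - N0); rewrite addrC subrK => /le_trans; apply.
  by apply: lerD => //; apply: le_trans tau_le.
have -> : X - W *m N2 *m W^T =
    (X - P *m X *m P) - W *m ((N1 - N0) + (N2 - N1)) *m W^T.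
  have -> : (N1 - N0) + (N2 - N1) = N2 - N0 by rewrite addrC addrA subrK.
  by rewrite -WN0 mulmxBr mulmxBl opprB addrA subrK.
rewrite (le_trans (frobB _ _)) // [leRHS]mulrDl lerD //.
rewrite [leRHS](_ : _ = frob W * ((e2 + e3) * d) * frob W); last by ring.
apply: frobM_le; last by rewrite frob_trmx.
apply: frobM_le => //; rewrite (le_trans (frobD _ _)) // mulrDl lerD //.
Qed.

End StrictComplementarity.
End Growth.

(** * The sketch: deterministic error *)

Section SketchError.
Variable R : realType.

Lemma proj_frob_le n p (P : 'M[R]_n) (Y : 'M[R]_(n, p)) :
  P^T = P -> P *m P = P -> frob (P *m Y) <= frob Y.
Proof.
move=> symP idemP; have [->|PY0] := eqVneq (frob (P *m Y)) 0.
  exact: frob_ge0.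
have PYp : 0 < frob (P *m Y) by rewrite lt_def PY0 frob_ge0.
rewrite -(ler_pM2r PYp) -expr2 frob_sqr inner_mulr symP mulmxA idemP innerC.
by rewrite (le_trans (ler_norm _)) // inner_le_frob.
Qed.

Lemma ortho_frob n p q (Q : 'M[R]_(n, p)) (Y : 'M[R]_(p, q)) :
  Q^T *m Q = 1%:M -> frob (Q *m Y) = frob Y.
Proof. by move=> QQ; rewrite /frob inner_mulr mulmxA QQ mul1mx. Qed.

Lemma ortho_proj n p (Q : 'M[R]_(n, p)) (P := Q *m Q^T) :
  Q^T *m Q = 1%:M -> P^T = P /\ P *m P = P.
Proof.
move=> QQ; split; first by rewrite trmx_mul trmxK.
by rewrite /P mulmxA -(mulmxA Q) QQ mulmx1.
Qed.

Lemma ortho_frob_tr n p q (Q : 'M[R]_(n, p)) (Y : 'M[R]_(n, q)) :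
  Q^T *m Q = 1%:M -> frob (Q^T *m Y) <= frob Y.
Proof.
move=> QQ; have [symP idemP] := ortho_proj QQ.
by rewrite -(ortho_frob _ QQ) mulmxA proj_frob_le.
Qed.

Section BoundedBelow.
Variables (k q : nat) (H : 'M[R]_(k, q)) (s : R).
Hypothesis s0 : 0 < s.
Hypothesis H_ge : forall x : 'cV[R]_q, s * frob x <= frob (H *m x).

Lemma bounded_below_inj p (Y : 'M[R]_(q, p)) : H *m Y = 0 -> Y = 0.
Proof.
move=> HY; apply/matrixP => i j; rewrite mxE.
have /(congr1 (fun v : 'cV[R]_q => v i 0)) : col j Y = 0; last by rewrite !mxE.
apply: frob_eq0; apply/eqP; rewrite eq_le frob_ge0 andbT -(ler_pM2l s0) mulr0.
by rewrite (le_trans (H_ge _)) // colE mulmxA HY mul0mx frob0.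
Qed.

(** H N is an orthogonal projection, so s |N e_j| <= |H N e_j| <= 1 for every unit vector e_j. *)
Lemma inner_inverse_bound (N : 'M[R]_(q, k)) :
  H *m N *m H = H -> (H *m N)^T = H *m N ->
  N *m H = 1%:M /\ frob N <= (q * k)%:R / s.
Proof.
move=> HNH symHN; split.
  apply/eqP; rewrite -subr_eq0; apply/eqP; apply: bounded_below_inj.
  by rewrite mulmxBr mulmx1 mulmxA HNH subrr.
apply: frob_le_entry; first by rewrite invr_ge0 ltW.
move=> i j; have -> : N i j = (N *m delta_mx j 0 : 'cV[R]_q) i 0.
  by rewrite -colE mxE.
rewrite (le_trans (frob_entry _ _ _)) // -div1r ler_pdivlMr // mulrC.
rewrite (le_trans (H_ge _)) // mulmxA (le_trans (proj_frob_le _ symHN _)) //.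
  by rewrite mulmxA HNH.
apply: frob_le => //; rewrite inner_sumE (bigD1 j) //= big_ord1 big1 ?addr0.
  by rewrite mxE !eqxx mulr1 expr1n.
by move=> i' i'j; rewrite big_ord1 mxE (negPf i'j) mul0r.
Qed.

Lemma moore_penrose_exists : exists N, moore_penrose H N.
Proof.
have freeH : row_free H^T.
  rewrite -kermx_eq0; apply/rowV0P => v /sub_kermxP vH.
  apply: trmx_inj; rewrite trmx0; apply: bounded_below_inj.
  by apply: trmx_inj; rewrite trmx_mul trmxK vH trmx0.
have := gram_unit freeH; rewrite trmxK => uH.
have symJ : (invmx (H^T *m H))^T = invmx (H^T *m H).
  by rewrite trmx_inv trmx_mul trmxK.
have NH : invmx (H^T *m H) *m H^T *m H = 1%:M by rewrite -mulmxA mulVmx.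
exists (invmx (H^T *m H) *m H^T); split.
- by rewrite -mulmxA NH mulmx1.
- by rewrite NH mul1mx.
- by move: (invmx _) symJ => J symJ; rewrite !trmx_mul trmxK symJ mulmxA.
- by rewrite NH trmx1.
Qed.

Lemma pseudoinverse_bound : pseudoinverse H *m H = 1%:M /\
  frob (pseudoinverse H) <= (q * k)%:R / s.
Proof.
have [N0 N0P] := moore_penrose_exists.
have [h1 _ h3 _] : moore_penrose H (pseudoinverse H).
  exact: (@xgetPex _ 0 [set N | moore_penrose H N] (ex_intro _ N0 N0P)).
exact: inner_inverse_bound.
Qed.

End BoundedBelow.

(** Let P = Q Q^T and let L be a left inverse of Psi^T W. As Xr Psi L^T W^T = Xr and (1 - P) X Psi =
    0, the range error (1 - P) X depends on X - Xr only. The error of B against Q^T X is the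
    pseudoinverse applied to Phi (1 - P) X. Truncation is controlled by comparing with Q^T Xr, whose
    rank is at most r. *)
Lemma sketch_error n q k p l r (X : 'M[R]_n) (W : 'M[R]_(n, q)) (N : 'M[R]_q)
    (Psi : 'M[R]_(n, k)) (Phi : 'M[R]_(l, n)) (Q : 'M[R]_(n, p))
    (U : 'M[R]_(p, k)) (Z : 'M[R]_(p, n)) (M1 M2 s1 s2 : R)
    (Xr := W *m N *m W^T) (B := pseudoinverse (Phi *m Q) *m (Phi *m X)) :
  (q <= r)%N -> X *m Psi = Q *m U -> Q^T *m Q = 1%:M ->
  best_rank_approx r B Z -> 0 < s1 -> 0 < s2 ->
  (forall x : 'cV[R]_q, s1 * frob x <= frob (Psi^T *m W *m x)) ->
  (forall x : 'cV[R]_p, s2 * frob x <= frob (Phi *m Q *m x)) ->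
  frob Psi <= M1 -> frob Phi <= M2 ->
  frob (Q *m Z - Xr) <=
    (2 * ((p * l)%:R / s2 * M2) + 3) *
    (1 + M1 * ((q * k)%:R / s1) * frob W) * frob (X - Xr).
Proof.
move=> qr XQ QQ [_ bestZ] s10 s20 W_ge Q_ge PsiM PhiM.
set d := frob (X - Xr); have d0 : 0 <= d by exact: frob_ge0.
have [LW L_le] : exists L : 'M[R]_(q, k), L *m (Psi^T *m W) = 1%:M /\
    frob L <= (q * k)%:R / s1.
  exists (pseudoinverse (Psi^T *m W)); exact: pseudoinverse_bound.
have [N_id N_le] := pseudoinverse_bound s20 Q_ge.
have [symP idemP] := ortho_proj QQ; set P := Q *m Q^T in symP idemP.
have [LE LB] := L_le.
set L1 := (q * k)%:R / s1 in LB *; set L2 := (p * l)%:R / s2 in N_le *.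
have L20 : 0 <= L2 by rewrite divr_ge0 // ltW.
have M20 : 0 <= M2 by apply: le_trans PhiM; exact: frob_ge0.
set e := (1 + M1 * L1 * frob W) * d.
have range_err : frob ((1%:M - P) *m X) <= e.
  have -> : (1%:M - P) *m X =
      (1%:M - P) *m ((X - Xr) - (X - Xr) *m (Psi *m LW^T *m W^T)).
    have XrE : Xr *m (Psi *m LW^T *m W^T) = Xr.
      have -> : Xr *m (Psi *m LW^T *m W^T) = W *m N *m (LW *m (Psi^T *m W))^T *m W^T.
        by rewrite !trmx_mul trmxK /Xr !mulmxA.
      by rewrite LE trmx1 mulmx1.
    have PQ : (1%:M - P) *m Q = 0 by rewrite mulmxBl mul1mx -mulmxA QQ mulmx1 subrr.
    rewrite (mulmxBl X Xr) XrE opprB addrA subrK [RHS]mulmxBr.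
    by rewrite -(mulmxA Psi) (mulmxA X) XQ -(mulmxA Q) (mulmxA _ Q) PQ mul0mx subr0.
  apply: le_trans (proj_frob_le _ _ _) _.
  - by rewrite linearB /= trmx1 symP.
  - by rewrite mulmxBl mul1mx mulmxBr mulmx1 idemP subrr subr0.
  rewrite (le_trans (frobB _ _)) // /e mulrDl mul1r -/d lerD2l mulrC.
  rewrite (le_trans (frobM _ _)) // -/d ler_wpM2l //.
  by apply: frobM_le; rewrite ?frob_trmx //; apply: frobM_le; rewrite ?frob_trmx.
have core_err : frob (B - Q^T *m X) <= L2 * M2 * e.
  have -> : B - Q^T *m X = pseudoinverse (Phi *m Q) *m Phi *m ((1%:M - P) *m X).
    rewrite mulmxBl mul1mx mulmxBr /B -!mulmxA; congr (_ - _).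
    by rewrite (mulmxA Phi) (mulmxA _ _ (Q^T *m X)) N_id mul1mx.
  by apply: frobM_le => //; apply: frobM_le.
have trunc_err : frob (B - Z) <= L2 * M2 * e + d.
  apply: le_trans (bestZ (Q^T *m Xr) _) _.
    rewrite (leq_trans (mxrankM_maxr _ _)) // (leq_trans (mxrankM_maxr _ _)) //.
    by rewrite (leq_trans (rank_leq_row _)).
  have -> : B - Q^T *m Xr = (B - Q^T *m X) + Q^T *m (X - Xr).
    by rewrite mulmxBr addrA subrK.
  by rewrite (le_trans (frobD _ _)) // lerD // ortho_frob_tr.
have -> : Q *m Z - Xr =
    (Q *m (B - Q^T *m X) - Q *m (B - Z)) + ((X - Xr) - (1%:M - P) *m X).
  rewrite !mulmxBr mulmxBl mul1mx (mulmxA Q Q^T X) -/P.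
  move: (Q *m Z) (Q *m B) (P *m X) (Xr) => x y z w.
  by apply/matrixP => i j; rewrite !mxE; ring.
have de : d <= e.
  rewrite /e ler_peMl // lerDl !mulr_ge0 ?frob_ge0 //.
    by apply: le_trans PsiM; exact: frob_ge0.
  by rewrite invr_ge0 ltW.
have := frobD (Q *m (B - Q^T *m X) - Q *m (B - Z)) ((X - Xr) - (1%:M - P) *m X).
have := frobB (Q *m (B - Q^T *m X)) (Q *m (B - Z)).
have := frobB (X - Xr) ((1%:M - P) *m X).
rewrite !(ortho_frob _ QQ) -/d -mulrA -/e.
move=> h1 h2 /le_trans; apply; apply: le_trans (lerD h2 h1) _.
rewrite [leRHS](_ : _ = L2 * M2 * e + (L2 * M2 * e + e) + (e + e)); last by ring.
by rewrite lerD // lerD // (le_trans trunc_err) // lerD2l.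
Qed.
End SketchError.

(** * The sketch: expected error *)

Section NormalBounds.
Variable R : realType.
Local Notation mu := (@lebesgue_measure R).

Lemma normal_pdf_le1 (x : R) : normal_pdf 0 1 x <= 1.
Proof.
apply: le_trans (normal_pdf_ub _ _ _) _; first exact: oner_neq0.
rewrite /normal_peak expr1n mul1r invf_le1.
  rewrite -[leLHS]sqrtr1 ler_wsqrtr //.
  have := pi_ge2 R; rewrite mulr2n; lra.
by rewrite sqrtr_gt0 mulrn_wgt0 // pi_gt0.
Qed.

Lemma normal_prob_itv (a b : R) : a <= b ->
  (normal_prob 0 1 `[a, b]%classic <= (b - a)%:E)%E.
Proof.
move=> ab; rewrite /normal_prob.
apply: (@le_trans _ _ (\int[mu]_(x in `[a, b]) (cst 1%E x))%E).
  apply: ge0_le_integral => //.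
  - by move=> x _; rewrite lee_fin normal_pdf_ge0.
  - apply/measurable_EFinP; apply: measurable_funTS.
    exact: measurable_normal_pdf.
  - by move=> x _; rewrite lee_fin normal_pdf_le1.
rewrite integral_cst // mul1e [leLHS](lebesgue_measure_itv `[a, b]) /=.
by case: ifPn => // _; rewrite lee_fin subr_ge0.
Qed.

(** Comparison with a wider normal density, whose total integral is known; the 2 is the ratio of the
    peaks. *)
Lemma normal_pdf_tail (M x : R) : 0 <= M -> M <= `|x| ->
  normal_pdf 0 1 x <= 2 * expR (- M ^+ 2 / 4) * normal_pdf 0 2 x.
Proof.
move=> M0 Mx; rewrite !normal_pdfE ?oner_neq0 // /normal_fun.
rewrite !subr0 /normal_peak expr1n mul1r.
have -> : Num.sqrt (2 ^+ 2 * pi *+ 2) = 2 * Num.sqrt (pi *+ 2) :> R.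
  by rewrite -mulrnAr sqrtrM ?sqr_ge0 // sqrtr_sqr ger0_norm.
have s0 : 0 < Num.sqrt (pi *+ 2) :> R by rewrite sqrtr_gt0 mulrn_wgt0 // pi_gt0.
rewrite [leRHS](_ : _ = (Num.sqrt (pi *+ 2))^-1 *
    (expR (- M ^+ 2 / 4) * expR (- x ^+ 2 / (2 ^+ 2 *+ 2)))); last first.
  by field; rewrite gt_eqF.
rewrite ler_pM2l ?invr_gt0 // -expRD ler_expR.
have : M ^+ 2 <= x ^+ 2 by rewrite -(real_normK (num_real x)) lerXn2r // nnegrE.
have -> : 2 ^+ 2 *+ 2 = 8 :> R by ring.
have := sqr_ge0 x; lra.
Qed.

Lemma normal_prob_tail (M : R) : 0 <= M ->
  (normal_prob 0 1 [set x | (M <= `|x|)%R] <= (2 * expR (- M ^+ 2 / 4))%:E)%E.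
Proof.
move=> M0; set c := 2 * _; have c0 : 0 <= c by rewrite mulr_ge0 ?expR_ge0.
have mA : measurable [set x : R | M <= `|x|].
  rewrite -[X in measurable X]setTI.
  by apply: measurable_fun_le => //; exact: measurable_normr.
rewrite /normal_prob.
have mf m s : measurable_fun [set: R] (fun x => (normal_pdf m s x)%:E).
  by apply/measurable_EFinP; exact: measurable_normal_pdf.
apply: (@le_trans _ _ (\int[mu]_(x in [set x | (M <= `|x|)%R])
   (c%:E * (normal_pdf 0 2 x)%:E))%E).
  apply: ge0_le_integral => //.
  - by move=> x _; rewrite lee_fin normal_pdf_ge0.
  - by apply: measurable_funTS; exact: mf.
  - by apply: measurable_funTS; apply: measurable_funeM; exact: mf.
  - by move=> x /= Mx; rewrite -EFinM lee_fin; exact: normal_pdf_tail.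
apply: (@le_trans _ _ (\int[mu]_x (c%:E * (normal_pdf 0 2 x)%:E))%E).
  apply: ge0_subset_integral => //; first by apply: measurable_funeM; exact: mf.
  by move=> x _; rewrite -EFinM lee_fin mulr_ge0 // normal_pdf_ge0.
rewrite ge0_integralZl_EFin ?integral_normal_pdf ?mule1 //.
  by move=> x _; rewrite lee_fin normal_pdf_ge0.
exact: mf.
Qed.

Lemma expR_inv_power (k : nat) : exists2 C : R, 0 <= C &
  forall w, 0 < w -> expR (- w ^+ 2 / 4) <= C / w ^+ (2 * k.+1).
Proof.
exists (4 ^+ k.+1 * (k.+1)`!%:R); first by rewrite mulr_ge0 ?exprn_ge0.
move=> w w0; have x0 : 0 <= w ^+ 2 / 4 by rewrite divr_ge0 ?sqr_ge0.
have := expR_ge1Dxn k x0 => H.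
have wp : 0 < w ^+ (2 * k.+1) by rewrite exprn_gt0.
have f0 : 0 < (k.+1)`!%:R :> R by rewrite ltr0n fact_gt0.
rewrite mulNr expRN -[leRHS]invrK lef_pV2 ?posrE ?expR_gt0 //; last first.
  by rewrite invr_gt0 divr_gt0 // mulr_gt0 // exprn_gt0.
apply: le_trans H; rewrite invf_div expr_div_n -exprM.
rewrite -[leLHS]add0r lerD // le_eqVlt; apply/orP; left; apply/eqP.
by field; rewrite ?expf_neq0 ?gt_eqF.
Qed.

End NormalBounds.

(** * Independence of one variable from all the others *)

Section Independence.
Context (R : realType) (d : measure_display) (Omega : measurableType d)
  (P : probability Omega R) (I : finType) (X : I -> {RV P >-> R}).
Hypothesis indepX : mutually_independent X.
Hypothesis normalX : forall e (E : set R), measurable E ->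
  distribution P (X e) E = normal_prob 0 1 E.

(* A pi-system generating the sigma-algebra of the variables other than X e. *)
Definition others (e : I) : set (set Omega) :=
  [set B | exists E : I -> set R, (forall i, measurable (E i)) /\
    B = \bigcap_(i in [set i | i != e]) (X i @^-1` E i)].

Lemma measurable_RV i (E : set R) : measurable E -> measurable (X i @^-1` E).
Proof. by move=> mE; rewrite -[X in measurable X]setTI; exact: measurable_funP. Qed.

Lemma others_measurable e : others e `<=` measurable.
Proof.
move=> _ [E [mE ->]]; apply: fin_bigcap_measurable; first exact: finite_finset.
by move=> i _; exact: measurable_RV.
Qed.

Lemma sigma_others_measurable e : <<s others e >> `<=` measurable.
Proof.
exact: (smallest_sub (@sigma_algebra_measurable _ _) (@others_measurable e)).
Qed.

Lemma others_setI e : setI_closed (others e).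
Proof.
move=> _ _ [E [mE ->]] [F [mF ->]]; exists (fun i => E i `&` F i); split.
  by move=> i; exact: measurableI.
by rewrite -bigcapI; apply: eq_bigcapr => i _; rewrite preimage_setI.
Qed.

Lemma others_setT e : others e setT.
Proof.
exists (fun=> setT); split=> //.
by rewrite bigcapT.
Qed.

(** Both sides are finite measures in B. They agree on the pi-system [others e] by mutual
    independence, hence on the sigma-algebra it generates. *)
Lemma indep_others e B (F : set R) : <<s others e >> B -> measurable F ->
  P (B `&` X e @^-1` F) = (P B * normal_prob 0 1 F)%E.
Proof.
move=> sB mF; have mXF := measurable_RV e mF.
pose c := fine (P (X e @^-1` F)).
have c0 : 0 <= c by exact: fine_ge0.
have cE : P (X e @^-1` F) = c%:E by rewrite fineK // fin_num_measure.
have -> : normal_prob 0 1 F = c%:E by rewrite -(normalX e) // -cE.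
rewrite muleC.
have := @g_sigma_algebra_measure_unique _ R _ (others e) (@others_measurable e)
  (fun=> setT) (fun=> others_setT e) _ (mrestr P mXF) (mscale (NngNum c0) P).
apply => //; first by rewrite bigcup_const.
- exact: others_setI.
- move=> _ [E [mE ->]]; rewrite /mrestr.
  set B0 := \bigcap_(i in _) _.
  transitivity (P (X e @^-1` F) * P B0)%E; last by rewrite cE.
  rewrite {}/B0.
  pose E' i := if i == e then F else E i.
  have mE' i : measurable (E' i) by rewrite /E'; case: ifP.
  have := indepX [set: I]%SET mE'.
  have -> : \bigcap_(i in [set` [set: I]%SET]) (X i @^-1` E' i) =
      \bigcap_(i in [set i | i != e]) (X i @^-1` E i) `&` X e @^-1` F.
    apply/seteqP; split => [w H|w [H He] i _].
      split => [i /= ie|]; last by have := H e (finset.in_setT _); rewrite /E' eqxx.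
      by have := H i (finset.in_setT _); rewrite /E' (negPf ie).
    by rewrite /E'; have [->//|/H] := eqVneq i e.
  move=> indepE; apply: (etrans indepE).
  rewrite (bigD1 e) //=.
  rewrite {1}/E' eqxx; congr (_ * _)%E.
  have := indepX (finset.setC (finset.set1 e)) mE.
  have -> : [set` finset.setC (finset.set1 e)] = [set i | i != e].
    by apply/seteqP; split=> i /=; rewrite !inE.
  move=> ->; apply: eq_big => [i|i /andP[_ ie]]; first by rewrite !inE.
  by rewrite /E' (negPf ie).
- by move=> k; rewrite /= /mrestr setTI cE ltry.
Qed.

Lemma measurable_others e i : i != e ->
  measurable_fun [set: g_sigma_algebraType (others e)] (X i : _ -> R).
Proof.
move=> ie _ E mE; rewrite setTI; apply: sub_sigma_algebra.
exists (fun j => if j == i then E else setT); split.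
  by move=> j; case: ifP.
apply/seteqP; split => [w Ew j /= je|w /(_ i ie)]; last by rewrite eqxx.
by case: eqP => [->|].
Qed.

End Independence.

(** * Small-ball estimates by resampling one entry *)

Section AntiConcentration.
Context (R : realType) (d : measure_display) (Omega : measurableType d)
  (P : probability Omega R) (I : finType) (X : I -> {RV P >-> R}).
Hypothesis indepX : mutually_independent X.
Hypothesis normalX : forall e (E : set R), measurable E ->
  distribution P (X e) E = normal_prob 0 1 E.

Local Notation sigma_others e := (g_sigma_algebraType (others X e)).

Lemma measurable_fun_others e (f : Omega -> R) :
  measurable_fun [set: sigma_others e] f -> measurable_fun [set: Omega] f.
Proof.
move=> mf _ E mE; rewrite setTI; apply: (@sigma_others_measurable _ _ _ P _ X e).
by have := mf measurableT E mE; rewrite setTI.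
Qed.

Section Entry.
Variables (e : I) (s k : R).
Hypotheses (s0 : 0 < s) (k0 : 0 < k).

(* On the cell Z j, the ratio -c/a is known up to h = s/k, so the event forces X e
   into a fixed interval of length 3h, independently of the cell. *)
Lemma small_ball_pos (B : set Omega) (a c : Omega -> R) :
  <<s others X e >> B ->
  measurable_fun [set: sigma_others e] a ->
  measurable_fun [set: sigma_others e] c ->
  (forall w, B w -> k <= a w) ->
  (P (B `&` [set w | `|(a w * X e w + c w)%R| <= s]%R)
    <= (3 * (s / k))%:E * P B)%E.
Proof.
move=> sB ma mc ak; set E := [set w | _].
have [h hE] : exists h, h = s / k by eexists.
have h0 : 0 < h by rewrite hE divr_gt0.
rewrite -hE.
have mB : measurable B by exact: sigma_others_measurable sB.
have mE : measurable E.
  rewrite -[X in measurable X]setTI; apply: measurable_fun_le => //.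
  apply: measurableT_comp => //; apply: measurable_funD.
    by apply: measurable_funM => //; exact: measurable_fun_others ma.
  exact: measurable_fun_others mc.
pose Z (j : int) := B `&` [set w | (j%:~R * h * a w <= - c w)%R]
  `&` [set w | (- c w < (j + 1)%:~R * h * a w)%R].
have sZ j : <<s others X e >> (Z j).
  have mZ (r : R) : measurable_fun [set: sigma_others e] (fun w => r * a w).
    by apply: measurable_funM.
  have mNc : measurable_fun [set: sigma_others e] (fun w => - c w).
    exact: measurable_funN.
  apply: (@measurableI _ (sigma_others e)).
    apply: (@measurableI _ (sigma_others e)) => //.
    by rewrite -[X in measurable X]setTI; apply: measurable_fun_le.
  have -> : [set w | - c w < (j + 1)%:~R * h * a w] =
      ~` [set w | (j + 1)%:~R * h * a w <= - c w].
    by apply/seteqP; split=> w /=; rewrite ltNge => /negP.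
  apply: measurableC; rewrite -[X in measurable X]setTI.
  exact: measurable_fun_le.
have mZ j : measurable (Z j) by exact: sigma_others_measurable (sZ j).
have PZ j : (P (Z j `&` E) <= (3 * h)%:E * P (Z j))%E.
  pose J : set R := `[(j%:~R - 1) * h, (j%:~R + 2) * h]%classic.
  apply: (@le_trans _ _ (P (Z j `&` X e @^-1` J))).
    apply: le_measure; rewrite ?inE; [exact: measurableI| |].
      by apply: measurableI => //; exact: measurable_RV (measurable_itv _).
    move=> w [[[Bw /= Z1] Z2] /= Ew]; split=> //; rewrite /J /= in_itv /=.
    have aw := ak _ Bw; have a0 : 0 < a w by exact: lt_le_trans aw.
    have sh : s <= h * a w by rewrite -[leLHS](@divfK _ k) ?gt_eqF // -hE ler_pM2l.
    have : `|a w * X e w + c w| <= s := Ew.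
    move: Z2; rewrite ler_norml intrD => Z2 /andP[E1 E2].
    rewrite -(ler_pM2r a0) -[X in _ && X](ler_pM2r a0) ![X e w * _]mulrC.
    by apply/andP; split; lra.
  have -> := indep_others indepX normalX (sZ j) (measurable_itv _).
  rewrite muleC lee_wpmul2r //.
  apply: le_trans (normal_prob_itv _) _; last by rewrite lee_fin; lra.
  by rewrite ler_pM2r //; lra.
pose Bn n := if @pickle_inv int n is Some j then Z j else set0.
have mBn n : measurable (Bn n) by rewrite /Bn; case: pickle_inv.
have tBn : trivIset setT Bn.
  apply/trivIsetP => i j _ _; rewrite /Bn.
  case Ei: (pickle_inv i) => [u|]; case Ej: (pickle_inv j) => [v|];
    rewrite ?set0I ?setI0 //.
  move=> ij; rewrite -subset0 => w [[[Bw /= u1] u2] [[_ /= v1] v2]].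
  have aw : 0 < h * a w by rewrite mulr_gt0 // (lt_le_trans k0) // ak.
  have := le_lt_trans u1 v2; have := le_lt_trans v1 u2.
  rewrite -!mulrA !ltr_pM2r // => vu uv.
  have {}vu : (v < u + 1)%R by rewrite -(ltr_int R).
  have {}uv : (u < v + 1)%R by rewrite -(ltr_int R).
  have uvE : u = v by lia.
  move/eqP: ij; apply.
  have := @pickle_invK int i; have := @pickle_invK int j.
  by rewrite Ei Ej /= uvE => -> ->.
have UBn : \bigcup_n Bn n = B.
  apply/seteqP; split => [w [n _]|w Bw].
    by rewrite /Bn; case: pickle_inv => // j [[]].
  have aw : 0 < h * a w by rewrite mulr_gt0 // (lt_le_trans k0) // ak.
  pose j := Num.floor (- c w / (h * a w)).
  exists (pickle j); first exact: Logic.I.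
  rewrite /Bn pickleK_inv.
  have /andP[j1 j2] := floor_itv (- c w / (h * a w)).
  split; first split => //=.
    by rewrite -mulrA -ler_pdivlMr.
  by rewrite /= -mulrA -ltr_pdivrMr.
apply: (@le_trans _ _ (\sum_(0 <= n <oo) P (Bn n `&` E))%E).
  apply: measure_sigma_subadditive => //.
  - by move=> n; exact: measurableI.
  - exact: measurableI.
  - by rewrite -setI_bigcupl UBn.
apply: (@le_trans _ _ (\sum_(0 <= n <oo) ((3 * h)%:E * P (Bn n)))%E).
  apply: lee_nneseries => // n _; rewrite /Bn; case: pickle_inv => [j|].
    exact: PZ.
  by rewrite set0I measure0 mule0.
rewrite nneseriesZl //; apply: lee_pmul => //.
- by rewrite lee_fin mulr_ge0 // ltW.
- by apply: nneseries_ge0.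
- by rewrite -measure_semi_bigcup ?UBn.
Qed.

(** Splitting B by the sign of [a] reduces to [small_ball_pos] and doubles the constant. *)
Lemma small_ball (B : set Omega) (a c : Omega -> R) :
  <<s others X e >> B ->
  measurable_fun [set: sigma_others e] a ->
  measurable_fun [set: sigma_others e] c ->
  (forall w, B w -> k <= `|a w|) ->
  (P (B `&` [set w | `|(a w * X e w + c w)%R| <= s]%R)
    <= (6 * (s / k))%:E * P B)%E.
Proof.
move=> sB ma mc ak; set E := [set w | _].
have mB : measurable B by exact: sigma_others_measurable sB.
have mE : measurable E.
  rewrite -[X in measurable X]setTI; apply: measurable_fun_le => //.
  apply: measurableT_comp => //; apply: measurable_funD.
    by apply: measurable_funM => //; exact: measurable_fun_others ma.
  exact: measurable_fun_others mc.
pose Bp := B `&` [set w | (0 <= a w)%R]; pose Bn := B `&` [set w | (a w <= 0)%R].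
have sBp : <<s others X e >> Bp.
  apply: (@measurableI _ (sigma_others e)) => //.
  by rewrite -[X in measurable X]setTI; apply: measurable_fun_le.
have sBn : <<s others X e >> Bn.
  apply: (@measurableI _ (sigma_others e)) => //.
  by rewrite -[X in measurable X]setTI; apply: measurable_fun_le.
have mBp : measurable Bp by exact: sigma_others_measurable sBp.
have mBn : measurable Bn by exact: sigma_others_measurable sBn.
have c0 : (0%:E <= (3 * (s / k))%:E)%E.
  by rewrite lee_fin mulr_ge0 // divr_ge0 // ltW.
have H1 := small_ball_pos sBp ma mc _.
have H2 := small_ball_pos sBn (measurable_funN ma) (measurable_funN mc) _.
have {H1} : (P (Bp `&` E) <= (3 * (s / k))%:E * P B)%E.
  apply: le_trans (H1 _) _.
    by move=> w [Bw /= aw]; have := ak _ Bw; rewrite ger0_norm.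
  apply: lee_wpmul2l; first exact: c0.
  by apply: le_measure; rewrite ?inE //; exact: subIsetl.
have {H2} : (P (Bn `&` E) <= (3 * (s / k))%:E * P B)%E.
  have -> : E = [set w | `|((\- a) w * X e w + (\- c) w)%R| <= s]%R.
    by apply/funext => w; rewrite /E /= mulNr -opprD normrN.
  apply: le_trans (H2 _) _.
    by move=> w [Bw /= aw]; have := ak _ Bw; rewrite ler0_norm.
  apply: lee_wpmul2l; first exact: c0.
  by apply: le_measure; rewrite ?inE //; exact: subIsetl.
move=> H2 H1.
have -> : (6 * (s / k))%:E = ((3 * (s / k))%:E + (3 * (s / k))%:E)%E.
  by rewrite -EFinD; congr EFin; ring.
rewrite ge0_muleDl //.
apply: le_trans (leeD H1 H2).
apply: le_trans (measureU2 _ _ _); [|exact: measurableI|exact: measurableI].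
apply: le_measure; rewrite ?inE; [exact: measurableI| |].
  by apply: measurableU; exact: measurableI.
move=> w [Bw Ew]; have [aw|aw] := leP 0 (a w); [left|right]; split=> //; split=> //.
exact: ltW.
Qed.

End Entry.
End AntiConcentration.

(** * Lower bounds on all unit vectors through a finite grid *)

Section Net.
Context (R : realType) (d : measure_display) (Omega : measurableType d)
  (P : probability Omega R) (I : finType) (X : I -> {RV P >-> R}).
Hypothesis indepX : mutually_independent X.
Hypothesis normalX : forall e (E : set R), measurable E ->
  distribution P (X e) E = normal_prob 0 1 E.
Local Notation sigma_others e := (g_sigma_algebraType (others X e)).

Lemma measure_bigcup_fin_le (T : finType) (F : T -> set Omega) (c : R) :
  (forall t, measurable (F t)) -> (forall t, (P (F t) <= c%:E)%E) ->
  (P (\bigcup_t F t) <= (#|T|%:R * c)%:E)%E.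
Proof.
move=> mF Fc.
have H (s : seq T) : measurable (\big[setU/set0]_(t <- s) F t) /\
    (P (\big[setU/set0]_(t <- s) F t) <= ((size s)%:R * c)%:E)%E.
  elim: s => [|t s [mU IH]]; first by rewrite big_nil measure0 mul0r.
  rewrite big_cons; split; first exact: measurableU.
  apply: le_trans (measureU2 _ _ _) _ => //.
  by rewrite /= -natr1 mulrDl mul1r addrC EFinD leeD.
have -> : \bigcup_t F t = \big[setU/set0]_(t <- enum T) F t.
  rewrite -bigcup_seq; apply/seteqP; split => [w [t _ Ft]|w [t _ Ft]].
    by exists t => //=; rewrite mem_enum.
  by exists t.
by rewrite cardE; case: (H (enum T)).
Qed.

Variables (l n p : nat) (entry : 'I_l -> 'I_n -> I).
Hypothesis entry_inj : forall i j i' j',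
  entry i j = entry i' j' -> i = i' /\ j = j'.
Variable V : Omega -> 'M[R]_(n, p).
Hypothesis mV : forall i j a b,
  measurable_fun [set: sigma_others (entry i j)] (fun w => V w a b).
Hypothesis mV_Omega : forall a b, measurable_fun [set: Omega] (fun w => V w a b).

Definition entry_mx (w : Omega) : 'M[R]_(l, n) := \matrix_(i, j) X (entry i j) w.

Definition rows_small (x : 'cV[R]_p) (j0 : 'I_n) (k s : R) (m : nat) : set Omega :=
  [set w | k <= `|(V w *m x) j0 0|] `&` \bigcap_(i in [set i : 'I_l | (i < m)%N])
    [set w | `|(entry_mx w *m (V w *m x)) i 0| <= s].

Let measurable_Vx (dT : measure_display) (T : measurableType dT)
    (W : T -> 'M[R]_(n, p)) (x : 'cV[R]_p) j :
  (forall a b, measurable_fun [set: T] (fun w => W w a b)) ->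
  measurable_fun [set: T] (fun w => (W w *m x) j 0).
Proof.
move=> mW; rewrite (_ : (fun w => _) = fun w => \sum_a W w j a * x a 0).
  by apply: measurable_sum => a; apply: measurable_funM.
by apply/funext => w; rewrite mxE.
Qed.

Let measurable_row (dT : measure_display) (T : measurableType dT)
    (W : T -> 'M[R]_(n, p)) (Y : 'I_n -> T -> R) (x : 'cV[R]_p) (Q : pred 'I_n) :
  (forall a b, measurable_fun [set: T] (fun w => W w a b)) ->
  (forall j, Q j -> measurable_fun [set: T] (Y j)) ->
  measurable_fun [set: T] (fun w => \sum_(j | Q j) Y j w * (W w *m x) j 0).
Proof.
move=> mW mY.
rewrite (_ : (fun w => _) = fun w => \sum_j
    (if Q j then Y j w else 0) * (W w *m x) j 0).
  apply: measurable_sum => j; apply: measurable_funM; last exact: measurable_Vx.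
  by case Qj: (Q j); [exact: mY|exact: measurable_cst].
apply/funext => w; rewrite big_mkcond; apply: eq_bigr => j _.
by case: ifP; rewrite ?mul0r.
Qed.

Let measurable_rows_small (dT : measure_display) (T : measurableType dT)
    (W : T -> 'M[R]_(n, p)) (Y : 'I_l -> 'I_n -> T -> R) (x : 'cV[R]_p)
    (j0 : 'I_n) (k s : R) (m : nat) :
  (forall a b, measurable_fun [set: T] (fun w => W w a b)) ->
  (forall (i : 'I_l) j, (i < m)%N -> measurable_fun [set: T] (Y i j)) ->
  measurable ([set w | k <= `|(W w *m x) j0 0|] `&`
    \bigcap_(i in [set i : 'I_l | (i < m)%N])
      [set w | `|\sum_j Y i j w * (W w *m x) j 0| <= s]).
Proof.
move=> mW mY; apply: measurableI.
  rewrite -[X in measurable X]setTI; apply: measurable_fun_le => //.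
  by apply: measurableT_comp => //; exact: measurable_Vx.
apply: fin_bigcap_measurable; first exact: finite_finset.
move=> i /= im; rewrite -[X in measurable X]setTI; apply: measurable_fun_le => //.
apply: measurableT_comp => //.
by apply: (@measurable_row _ _ W (Y i) x xpredT) => // j _; exact: mY.
Qed.

Lemma rows_smallE x j0 k s m : rows_small x j0 k s m =
  [set w | k <= `|(V w *m x) j0 0|] `&` \bigcap_(i in [set i : 'I_l | (i < m)%N])
    [set w | `|\sum_j X (entry i j) w * (V w *m x) j 0| <= s].
Proof.
congr setI; apply: eq_bigcapr => i _; apply/funext => w /=.
rewrite mxE; congr (is_true (`|_| <= s)); apply: eq_bigr => j _.
by congr (_ * _); rewrite mxE.
Qed.

Lemma rows_small_measurable x j0 k s m : measurable (rows_small x j0 k s m).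
Proof.
by rewrite rows_smallE; apply: measurable_rows_small.
Qed.

(** Rows are added one at a time. Neither V nor the rows before the new one involve its entry in
    column j0, so [small_ball] applies on the event for the earlier rows, and each row contributes
    one factor. *)
Lemma rows_small_le x j0 k s m : 0 < k -> 0 < s -> (m <= l)%N ->
  (P (rows_small x j0 k s m) <= ((6 * (s / k)) ^+ m)%:E)%E.
Proof.
move=> k0 s0; elim: m => [_|m IH ml].
  rewrite expr0; exact: probability_le1 (rows_small_measurable _ _ _ _ _).
pose i0 := Ordinal ml; pose e := entry i0 j0.
have -> : rows_small x j0 k s m.+1 = rows_small x j0 k s m `&`
    [set w | `|(V w *m x) j0 0 * X e w +
      \sum_(j | j != j0) X (entry i0 j) w * (V w *m x) j 0| <= s].
  have rowE w : \sum_j X (entry i0 j) w * (V w *m x) j 0 =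
     (V w *m x) j0 0 * X e w +
      \sum_(j | j != j0) X (entry i0 j) w * (V w *m x) j 0.
    by rewrite (bigD1 j0) //= mulrC.
  rewrite !rows_smallE; apply/seteqP; split => [w [H1 H2]|w [[H1 H2] H3]].
    split; last by rewrite /= -rowE; apply: H2 => /=.
    by split=> // i /= im; apply: H2 => /=; exact: ltnW.
  split=> // i /=; rewrite ltnS leq_eqVlt => /orP[/eqP im|im]; last exact: H2.
  have -> : i = i0 by exact: val_inj.
  by rewrite rowE.
apply: le_trans (small_ball indepX normalX s0 k0 (e := e) _ _ _ _) _.
- rewrite rows_smallE; apply: (@measurable_rows_small _ (sigma_others e)).
    by move=> a b; exact: mV.
  move=> i j im; apply: measurable_others; apply/eqP => /entry_inj[ii0 _].
  by rewrite ii0 /= ltnn in im.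
- by apply: (@measurable_Vx _ (sigma_others e)) => a b; exact: mV.
- apply: (@measurable_row _ (sigma_others e)) => [a b|j jj0]; first exact: mV.
  by apply: measurable_others; apply: contra_neq jj0 => /entry_inj[].
- by move=> w [].
rewrite exprS [leRHS]EFinM lee_wpmul2l //; last by apply: IH; exact: ltnW.
by rewrite lee_fin mulr_ge0 // divr_ge0 // ltW.
Qed.

Definition grid_pt (N : nat) (f : {ffun 'I_p -> 'I_(2 * N + 1)}) : 'cV[R]_p :=
  \col_i (((f i : nat)%:R - N%:R) / N%:R).

Lemma grid_approx (N : nat) (x : 'cV[R]_p) : (0 < N)%N ->
  (forall i, `|x i 0| <= 1) ->
  exists f : {ffun 'I_p -> 'I_(2 * N + 1)},
    forall i, `|x i 0 - grid_pt f i 0| <= (N%:R)^-1 :> R.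
Proof.
move=> N0 x1; have Np : 0 < N%:R :> R by rewrite ltr0n.
pose y i := (x i 0 + 1) * N%:R.
have y0 i : 0 <= y i.
  by have := x1 i; rewrite ler_norml => /andP[? _]; rewrite mulr_ge0 //; lra.
have y2 i : y i <= (2 * N)%:R.
  have := x1 i; rewrite ler_norml => /andP[_ ?].
  by rewrite natrM ler_pM2r //; lra.
have f_lt i : (Num.truncn (y i) < 2 * N + 1)%N.
  rewrite addn1 ltnS -(ler_nat R); apply: le_trans (y2 i).
  by rewrite truncn_le.
exists [ffun i => Ordinal (f_lt i)] => i; rewrite mxE ffunE /=.
have /andP[t1 t2] := truncn_itv (y0 i).
have -> : x i 0 - ((Num.truncn (y i))%:R - N%:R) / N%:R =
    (y i - (Num.truncn (y i))%:R) / N%:R by rewrite /y; field; rewrite gt_eqF.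
rewrite ger0_norm; last by rewrite divr_ge0 // subr_ge0.
rewrite ler_pdivrMr // mulVf ?gt_eqF //; move: t2; rewrite -natr1; lra.
Qed.

Definition net_bad (k s : R) (N : nat) : set Omega :=
  \bigcup_(t : {ffun 'I_p -> 'I_(2 * N + 1)} * 'I_n)
    rows_small (grid_pt t.1) t.2 k s l.

Lemma net_bad_measurable k s N : measurable (net_bad k s N).
Proof.
apply: fin_bigcup_measurable; first exact: finite_finset.
by move=> t _; exact: rows_small_measurable.
Qed.

Lemma net_bad_le k s N : 0 < k -> 0 < s ->
  (P (net_bad k s N) <= (((2 * N + 1) ^ p * n)%:R * (6 * (s / k)) ^+ l)%:E)%E.
Proof.
move=> k0 s0.
have -> : ((2 * N + 1) ^ p * n)%N = #|{: {ffun 'I_p -> 'I_(2 * N + 1)} * 'I_n}|.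
  by rewrite card_prod card_ffun !card_ord.
apply: measure_bigcup_fin_le => t; first exact: rows_small_measurable.
exact: rows_small_le.
Qed.

(** Replacing a unit vector by a nearby grid point lowers its large coordinate under V by at most k
    / 2 and raises each row of the image by at most s, so a unit vector with image below s puts w
    into [net_bad (k / 2) (2 * s) N]. *)
Lemma net_cover (k s M b : R) (N : nat) w : 0 < k -> 0 < s -> 0 <= M -> 0 <= b ->
  (0 < N)%N -> p%:R * b / N%:R <= k / 2 ->
  n%:R * (M * (p%:R * b / N%:R)) <= s ->
  (forall i j, `|X (entry i j) w| <= M) -> (forall a c, `|V w a c| <= b) ->
  (forall x : 'cV[R]_p, frob x = 1 -> exists j, k <= `|(V w *m x) j 0|) ->
  ~ net_bad (k / 2) (2 * s) N w ->
  forall x : 'cV[R]_p, s * frob x <= frob (entry_mx w *m V w *m x).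
Proof.
move=> k0 s0 M0 b0 N0 Nk Ns XM Vb Vk notbad.
have unit_case (x : 'cV[R]_p) : frob x = 1 -> s <= frob (entry_mx w *m V w *m x).
  move=> x1; rewrite leNgt; apply/negP => small; apply: notbad.
  have [j kj] := Vk x x1.
  have [f fx] : exists f : {ffun 'I_p -> 'I_(2 * N + 1)},
      forall i, `|x i 0 - grid_pt f i 0| <= (N%:R)^-1 :> R.
    by apply: grid_approx => // i; rewrite -x1; exact: frob_entry.
  have Vdiff a : `|(V w *m (x - grid_pt f)) a 0| <= p%:R * b / N%:R.
    rewrite mxE (le_trans (ler_norm_sum _ _ _)) //.
    apply: (@le_trans _ _ (\sum_(i < p) b / N%:R)); last first.
      by rewrite sumr_const card_ord -[leLHS]mulr_natl mulrA.
    by apply: ler_sum => i _; rewrite normrM !mxE ler_pM //; have := fx i; rewrite mxE.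
  exists (f, j) => //; split => /=.
    have -> : V w *m grid_pt f = V w *m x - V w *m (x - grid_pt f).
      by rewrite mulmxBr subKr.
    rewrite mxE [X in _ + X]mxE; apply: le_trans (lerB_dist _ _).
    have := Vdiff j; lra.
  move=> i /= _.
  have -> : V w *m grid_pt f = V w *m x - V w *m (x - grid_pt f).
    by rewrite mulmxBr subKr.
  rewrite mulmxBr mxE [X in _ + X]mxE (le_trans (ler_normB _ _)) //.
  rewrite mulr2n mulrDl mul1r lerD //.
    by rewrite mulmxA (le_trans (frob_entry _ _ _)) // ltW.
  rewrite mxE (le_trans (ler_norm_sum _ _ _)) //; apply: le_trans Ns.
  apply: (@le_trans _ _ (\sum_(j < n) M * (p%:R * b / N%:R))); last first.
    by rewrite sumr_const card_ord -[leLHS]mulr_natl.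
  by apply: ler_sum => a _; rewrite normrM mxE ler_pM.
move=> x; have [x0|x0] := eqVneq (frob x) 0.
  by rewrite x0 mulr0 frob_ge0.
have xp : 0 < frob x by rewrite lt_def x0 frob_ge0.
have := unit_case ((frob x)^-1 *: x).
rewrite frobZ ger0_norm ?invr_ge0 ?frob_ge0 // mulVf // => /(_ erefl).
rewrite -scalemxAr frobZ ger0_norm ?invr_ge0 ?frob_ge0 //.
by rewrite ler_pdivlMl // mulrC.
Qed.

End Net.

(** * Borel maps of matrices with measurable entries *)

Section BorelMatrix.
Context (R : realType) (dT : measure_display) (T : measurableType dT).

Let rat_box n k (u : 'M[rat]_(n, k) * rat) : set 'M[R]_(n, k) :=
  [set M | forall i j, `|ratr (u.1 i j) - M i j| < ratr u.2].

Let preimage_rat_box n k (f : T -> 'M[R]_(n, k)) u :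
  (forall i j, measurable_fun [set: T] (fun w => f w i j)) ->
  measurable (f @^-1` rat_box u).
Proof.
move=> mf.
have -> : f @^-1` rat_box u = \bigcap_(t in [set: 'I_n * 'I_k])
    ~` [set w | ratr u.2 <= `|ratr (u.1 t.1 t.2) - f w t.1 t.2|].
  apply/seteqP; split => [w H t _ /=|w H i j].
    by apply/negP; rewrite -ltNge; exact: H.
  by have /= /negP := H (i, j) Logic.I; rewrite -ltNge.
apply: fin_bigcap_measurable; first exact: finite_finset.
move=> t _; apply: measurableC; rewrite -[X in measurable X]setTI.
apply: measurable_fun_le => //; apply: measurableT_comp => //.
exact: measurable_funB.
Qed.

(** An open set is the union of the countably many rational boxes that it contains. *)
Lemma measurable_preimage_open n k (f : T -> 'M[R]_(n, k)) (U : set 'M[R]_(n, k)) :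
  (forall i j, measurable_fun [set: T] (fun w => f w i j)) ->
  open U -> measurable (f @^-1` U).
Proof.
move=> mf oU.
pose F u := if `[< rat_box u `<=` U >] then f @^-1` rat_box u else set0.
have -> : f @^-1` U = \bigcup_u F u.
  apply/seteqP; split => [w Uw|w [u _]]; last first.
    by rewrite /F; case: asboolP => // uU; exact: uU.
  have : nbhs (f w) U by exact: open_nbhs_nbhs.
  move=> /nbhs_ballP[e /= e0 eU].
  have [d] : exists d : rat, ratr d \in `]0, e / 2[.
    by apply: rat_in_itvoo; rewrite divr_gt0.
  rewrite in_itv /= => /andP[d0 de].
  have qP i j : exists q : rat, `|ratr q - f w i j| < ratr d.
    have [|q] := @rat_in_itvoo R (f w i j - ratr d) (f w i j + ratr d); first lra.
    by rewrite in_itv /= -ltr_distl => qd; exists q.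
  pose q i j := projT1 (cid (qP i j)).
  pose u := (\matrix_(i, j) q i j, d).
  exists u => //; rewrite /F ifT.
    by move=> i j; rewrite mxE /=; exact: (projT2 (cid (qP i j))).
  apply/asboolP => M MU; apply: eU; split=> // i j.
  have := MU i j; rewrite mxE /= => h1; have h2 := projT2 (cid (qP i j)).
  rewrite /ball /= -[f w i j - _](subrKA (ratr (q i j))).
  by rewrite (le_lt_trans (ler_normD _ _)) // distrC; rewrite -/(q i j) in h2; lra.
apply: countable_bigcupT_measurable; first exact: countableP.
move=> u; rewrite /F.
by case: ifP => // _; exact: preimage_rat_box.
Qed.

Lemma measurable_borel_entry n k p q (f : T -> 'M[R]_(n, k))
    (g : 'M[R]_(n, k) -> 'M[R]_(p, q)) :
  (forall i j, measurable_fun [set: T] (fun w => f w i j)) -> borel g ->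
  forall a b, measurable_fun [set: T] (fun w => g (f w) a b).
Proof.
move=> mf bg a b.
have sub : <<s open >> `<=` [set B | measurable (f @^-1` B)].
  apply: smallest_sub; last by move=> U; exact: measurable_preimage_open.
  split=> /= [|B mB|B mB].
  - by rewrite preimage_set0.
  - by rewrite setTD preimage_setC; exact: measurableC.
  - by rewrite preimage_bigcup; exact: bigcupT_measurable.
apply: (measurability _ (RGenOInfty.measurableE R)) => _ [_ [x ->] <-].
rewrite setTI.
have oU : open ((fun M : 'M[R]_(p, q) => M a b) @^-1` `]x, +oo[%classic).
  apply: open_comp; last exact: interval_open.
  by move=> M _; exact: coord_continuous.
exact: (sub _ (bg _ oU)).
Qed.

End BorelMatrix.

(** * Expectation bounds from a sequence of exceptional events *)

Section Levels.
Context (R : realType) (d : measure_display) (Omega : measurableType d)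
  (P : probability Omega R).

(** The integral of a nonnegative function is a supremum over the simple functions below it, hence
    monotone without measurability. *)
Lemma integral_le_nonmeasurable (f g : Omega -> \bar R) :
  (forall w, 0 <= f w)%E -> (forall w, f w <= g w)%E ->
  (\int[P]_w f w <= \int[P]_w g w)%E.
Proof.
move=> f0 fg; have g0 w : (0 <= g w)%E by exact: le_trans (fg w).
rewrite !ge0_integralE //; apply: le_ereal_sup => _ [h hf <-].
by exists h => // w; rewrite (le_trans (hf w)) // !patch_setT.
Qed.

(** f is dominated by c + sum_j u_j 1_(bad j): if j + 1 is the first index whose event does not
    hold, then [bad j] holds and f <= u_j. The expected terms decay like 2^-j because 17 exceeds
    16. *)
Lemma expectation_le_levels (f : Omega -> R) (bad : nat -> set Omega) (c C : R) :
  0 < c -> 0 <= C -> (forall w, 0 <= f w) -> (forall j, measurable (bad j)) ->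
  (forall j, (P (bad j) <= (C / 2 ^+ (17 * j))%:E)%E) ->
  (forall j w, ~ bad j w -> f w <= c * 2 ^+ (16 * j)) ->
  ('E_P[f] <= (c * (1 + C * 2 ^+ 17))%:E)%E.
Proof.
move=> c0 C0 f0 mbad Pbad fbad.
pose u j : R := c * 2 ^+ (16 * j.+1).
have u0 j : 0 <= u j by rewrite mulr_ge0 ?exprn_ge0 // ltW.
pose g w : \bar R := (c%:E + \sum_(0 <= j <oo) ((u j)%:E * (\1_(bad j) w)%:E))%E.
have term0 j w : (0 <= (u j)%:E * (\1_(bad j) w)%:E)%E.
  by rewrite -EFinM lee_fin mulr_ge0.
have series0 w : (0 <= \sum_(0 <= j <oo) ((u j)%:E * (\1_(bad j) w)%:E))%E.
  by apply: nneseries_ge0 => j _ _; exact: term0.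
have mterm j : measurable_fun [set: Omega] (fun w => (u j)%:E * (\1_(bad j) w)%:E)%E.
  by apply: measurable_funeM; apply/measurable_EFinP; exact: measurable_indic.
have fg w : ((f w)%:E <= g w)%E.
  have term_le j : bad j w -> f w <= u j -> ((f w)%:E <= g w)%E.
    move=> bj fu; apply: (@le_trans _ _ (u j)%:E); first by rewrite lee_fin.
    rewrite /g -[leLHS]add0e leeD //; first by rewrite lee_fin ltW.
    apply: le_trans (nneseries_lim_ge j.+1 (fun n _ _ => term0 n w)).
    rewrite big_nat_recr //= -[leLHS]add0e leeD //.
      by apply: sume_ge0 => i _; exact: term0.
    by rewrite indicE mem_set // mule1.
  have [[j /asboolP bj]|allbad] := pselect (exists j, `[< ~ bad j w >]).
    have exj : exists j, `[< ~ bad j w >] by exists j; apply/asboolP.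
    case: (ex_minnP exj) => {j bj} [[|j] /asboolP bj minj].
      apply: (@le_trans _ _ c%:E); last by rewrite /g leeDl.
      by rewrite lee_fin; have := fbad _ _ bj; rewrite muln0 expr0 mulr1.
    apply: (term_le j); last exact: fbad.
    apply: contrapT => nbj.
    by have := minj j (introT (asboolP _) nbj); rewrite ltnn.
  have {}allbad j : bad j w.
    by apply: contrapT => nbj; apply: allbad; exists j; apply/asboolP.
  (* If w lies in every [bad j], any term with u_j >= f w suffices. *)
  pose j := Num.truncn (f w / c); apply: (term_le j) => //.
  rewrite /u -ler_pdivrMl // mulrC.
  have /andP[_ /ltW fj] : 
      (Num.truncn (f w / c))%:R <= f w / c < (Num.truncn (f w / c)).+1%:R.
    by apply: truncn_itv; rewrite divr_ge0 // ltW.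
  rewrite (le_trans fj) // -/j -natrX ler_nat.
  apply: leq_trans (ltnW (ltn_expl j.+1 (isT : 1 < 2)%N)) _.
  by rewrite leq_exp2l //; lia.
rewrite unlock; apply: le_trans (integral_le_nonmeasurable _ fg) _.
  by move=> w; rewrite lee_fin.
have mseries : measurable_fun [set: Omega]
    (fun w => \sum_(0 <= j <oo) ((u j)%:E * (\1_(bad j) w)%:E))%E.
  by apply: ge0_emeasurable_sum.
rewrite /g ge0_integralD //; last by move=> w _; rewrite lee_fin ltW.
rewrite integral_cst // [X in (_ * X + _)%E](_ : _ = 1%E); last exact: probability_setT.
rewrite mule1 mulrDr mulr1 EFinD leeD2l //.
rewrite integral_nneseries //.
have termE j : (\int[P]_w ((u j)%:E * (\1_(bad j) w)%:E) <=
    ((c * C * 2 ^+ 17) / (2 ^ (j + 1))%:R)%:E)%E.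
  rewrite ge0_integralZl_EFin //; last first.
    by apply/measurable_EFinP; exact: measurable_indic.
  rewrite integral_indic // setIT.
  apply: le_trans (lee_wpmul2l _ (Pbad j)) _; first by rewrite lee_fin.
  have -> : (17 * j = 16 * j + j)%N by lia.
  rewrite -EFinM lee_fin /u natrX mulnS !exprD le_eqVlt.
  apply/orP; left; apply/eqP; field.
  by rewrite !expf_neq0.
apply: le_trans (lee_nneseries _ (fun j _ => termE j)) _.
  by move=> j _ _; exact: integral_ge0.
have -> : (c * (C * 2 ^+ 17)) = (c * C * 2 ^+ 17) / 2 ^+ 0 by rewrite expr0 divr1 mulrA.
have /cvg_lim <- // := @cvg_geometric_eseries_half R (c * C * 2 ^+ 17) 0.
Qed.

End Levels.

(** * Probabilities of the exceptional events at level j *)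

Section Tails.
Context (R : realType) (d : measure_display) (Omega : measurableType d)
  (P : probability Omega R) (I : finType) (X : I -> {RV P >-> R}).
Hypothesis indepX : mutually_independent X.
Hypothesis normalX : forall e (E : set R), measurable E ->
  distribution P (X e) E = normal_prob 0 1 E.
Local Notation sigma_others e := (g_sigma_algebraType (others X e)).

Lemma tail_level : exists2 C : R, 0 <= C & forall j, exists bad : set Omega,
  [/\ measurable bad, (P bad <= (C / 2 ^+ (17 * j))%:E)%E &
    forall w, ~ bad w -> forall e, `|X e w| <= 2 ^+ j].
Proof.
(* This gives the power 2 * 9 = 18, which is at least 17. *)
have [D' D'0 expD'] := expR_inv_power R 8.
pose D : R := 2 * D'; have D0 : 0 <= D by rewrite mulr_ge0.
exists (#|I|%:R * D); first exact: mulr_ge0.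
move=> j; pose M : R := 2 ^+ j; have M0 : 0 < M by rewrite exprn_gt0.
pose A : set R := [set x | M <= `|x|].
have mA : measurable A.
  by rewrite -[X in measurable X]setTI; apply: measurable_fun_le.
exists (\bigcup_e (X e @^-1` A)).
have mXA e : measurable (X e @^-1` A) by exact: measurable_RV mA.
split=> [||w nbad e].
- by apply: fin_bigcup_measurable; [exact: finite_finset|].
- rewrite -mulrA; apply: measure_bigcup_fin_le => // e.
  have -> : P (X e @^-1` A) = normal_prob 0 1 A by rewrite -(normalX e).
  apply: le_trans (normal_prob_tail (ltW M0)) _; rewrite lee_fin.
  rewrite /D -mulrA ler_wpM2l //.
  apply: le_trans (expD' _ M0) _.
  rewrite ler_wpM2l // lef_pV2 ?posrE ?exprn_gt0 //.
  by rewrite /M -exprM ler_eXn2l ?ltr1n //; lia.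
rewrite leNgt; apply/negP => Me; apply: nbad; exists e => //=.
exact: ltW.
Qed.

Section NetLevel.
Variables (l n p : nat) (entry : 'I_l -> 'I_n -> I).
Hypothesis entry_inj : forall i j i' j',
  entry i j = entry i' j' -> i = i' /\ j = j'.

(** With entries up to 2^j, resolving images at scale 2^(-a j) takes a mesh of order 2^(-(a + 1) j),
    hence about 2^((a + 1) j p) grid points, each bad with probability of order 2^(-a j l). The
    condition on [a] leaves 2^(-17 j). The constant precedes V, since the Q used later changes with
    the sketched matrix. *)
Lemma net_level (a : nat) (k b : R) : 0 < k -> 0 <= b ->
  ((a + 1) * p + 17 <= a * l)%N ->
  exists2 C : R, 0 <= C & forall V : Omega -> 'M[R]_(n, p),
    (forall i j x y,
      measurable_fun [set: sigma_others (entry i j)] (fun w => V w x y)) ->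
    (forall x y, measurable_fun [set: Omega] (fun w => V w x y)) ->
    (forall w x y, `|V w x y| <= b) ->
    (forall w (x : 'cV[R]_p), frob x = 1 -> exists j, k <= `|(V w *m x) j 0|) ->
    forall j, exists bad : set Omega,
      [/\ measurable bad, (P bad <= (C / 2 ^+ (17 * j))%:E)%E &
        forall w, ~ bad w -> (forall e, `|X e w| <= 2 ^+ j) ->
        forall x : 'cV[R]_p,
          (2 ^+ (a * j))^-1 * frob x <= frob (entry_mx X entry w *m V w *m x)].
Proof.
move=> k0 b0 apl.
pose B : R := 2 * (p%:R * b) / k + n%:R * (p%:R * b).
have B0 : 0 <= B by rewrite addr_ge0 ?divr_ge0 ?mulr_ge0 // ltW.
pose A := (Num.truncn B).+1.
have BA : B <= A%:R by have /andP[_ /ltW] := truncn_itv B0.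
have A0 : 0 < A%:R :> R by rewrite ltr0n.
have BA1 : p%:R * b / A%:R <= k / 2.
  rewrite ler_pdivrMr // -ler_pdivrMl ?divr_gt0 //; apply: le_trans BA.
  rewrite invf_div mulrAC /B lerDl !mulr_ge0 //.
have BA2 : n%:R * (p%:R * b) / A%:R <= 1.
  rewrite ler_pdivrMr // mul1r; apply: le_trans BA.
  by rewrite lerDr divr_ge0 ?mulr_ge0 // ltW.
pose C : R := ((3 * A) ^ p * n)%:R * (24 / k) ^+ l.
exists C; first by rewrite mulr_ge0 ?exprn_ge0 // divr_ge0 // ltW.
move=> V mV mVO Vb Vk j.
pose s : R := (2 ^+ (a * j))^-1; have s0 : 0 < s by rewrite invr_gt0 exprn_gt0.
pose N := (A * 2 ^ ((a + 1) * j))%N.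
have N0 : (0 < N)%N by rewrite muln_gt0 expn_gt0.
have NE : N%:R = A%:R * 2 ^+ ((a + 1) * j) :> R by rewrite natrM natrX.
have p2 (i : nat) : 0 < 2 ^+ i :> R by rewrite exprn_gt0.
exists (net_bad X entry V (k / 2) (2 * s) N); split.
- exact: net_bad_measurable.
- have k20 : 0 < k / 2 by rewrite divr_gt0.
  have s20 : 0 < 2 * s by rewrite mulr_gt0.
  apply: le_trans (net_bad_le indepX normalX entry_inj mV mVO N k20 s20) _.
  rewrite lee_fin.
  have -> : 6 * (2 * s / (k / 2)) = 24 / k * s by field; rewrite gt_eqF.
  apply: (@le_trans _ _ (((3 * N) ^ p * n)%:R * (24 / k * s) ^+ l)).
    apply: ler_wpM2r; first by rewrite exprn_ge0 // mulr_ge0 ?divr_ge0 // ltW.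
    rewrite ler_nat leq_mul2r; apply/orP; right.
    have N3 : (2 * N + 1 <= 3 * N)%N by rewrite -[3%N]/(2 + 1)%N mulnDl mul1n leq_add2l.
    by case: (p) => // p'; rewrite leq_exp2r.
  rewrite exprMn /C /N.
  have -> : ((3 * (A * 2 ^ ((a + 1) * j))) ^ p * n =
      (3 * A) ^ p * n * 2 ^ ((a + 1) * j * p))%N.
    by rewrite mulnA expnMn -expnM mulnAC.
  rewrite natrM natrX -!mulrA ler_wpM2l // mulrCA.
  rewrite ler_wpM2l ?exprn_ge0 ?divr_ge0 ?(ltW k0) //.
  rewrite /s exprVn -exprM ler_pdivrMr // ler_pdivlMl // -exprD ler_eXn2l ?ltr1n //.
  rewrite [((a + 1) * j * p)%N]mulnAC [(a * j * l)%N]mulnAC -mulnDl.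
  by rewrite addnC leq_mul2r apl orbT.
move=> w nbad XM; apply: (net_cover (M := 2 ^+ j) (b := b) (k := k) (N := N)) => //.
- rewrite NE; apply: le_trans BA1; rewrite invfM mulrA.
  rewrite ler_piMr ?mulr_ge0 ?invr_ge0 // invf_le1 // exprn_ege1 //.
  by rewrite ler1n.
- rewrite NE addnC mulnDl mul1n exprD /s.
  rewrite [leLHS](_ : _ = (n%:R * (p%:R * b) / A%:R) * (2 ^+ (a * j))^-1).
    by rewrite ler_piMl // invr_ge0.
  by field; rewrite !expf_neq0 ?gt_eqF.
exact: Vk.
Qed.

End NetLevel.
End Tails.

(** * Expected error of the sketched solution *)

Section SketchExpectation.
Context (R : realType) (n r q : nat) (d : measure_display)
  (Omega : measurableType d) (P : probability Omega R).
Local Notation k := (2 * r + 1)%N.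
Local Notation l := (4 * r + 3)%N.
Local Notation p := (minn n k).
Variables (Psi : 'I_n -> 'I_k -> {RV P >-> R}) (Phi : 'I_l -> 'I_n -> {RV P >-> R}).
Variables (qr : 'M[R]_(n, k) -> 'M[R]_(n, p) * 'M[R]_(p, k))
  (trunc : 'M[R]_(p, n) -> 'M[R]_(p, n)).
Hypotheses (gauss : gaussian_sketch Psi Phi) (qrP : qr_routine qr)
  (truncP : rank_routine r trunc).
Variables (W : 'M[R]_(n, q)) (G : 'M[R]_(q, n)).
Hypotheses (GW : G *m W = 1%:M) (q_le_r : (q <= r)%N).

Local Notation Psi_ w := (random_matrix Psi w).
Local Notation Phi_ w := (random_matrix Phi w).

Let X (e : 'I_n * 'I_k + 'I_l * 'I_n) : {RV P >-> R} :=
  match e with inl ij => Psi ij.1 ij.2 | inr ij => Phi ij.1 ij.2 end.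

Let indepX : mutually_independent X. Proof. by case: gauss. Qed.

Let normalX e (E : set R) : measurable E ->
  distribution P (X e) E = normal_prob 0 1 E.
Proof. by case: gauss => _; exact. Qed.

Lemma large_coordinate m (y : 'cV[R]_m) (c : R) :
  0 <= c -> m%:R * c < frob y -> exists j, c <= `|y j 0|.
Proof.
move=> c0; apply: contraPP => /forallNP small; apply/negP; rewrite -leNgt.
rewrite -[m in m%:R]muln1; apply: frob_le_entry => // i j.
by rewrite ord1; have /negP := small i; rewrite -ltNge => /ltW.
Qed.

Let kW : R := ((frob G + 1) * (n%:R + 1))^-1.

Let kW_gt0 : 0 < kW.
Proof. by rewrite invr_gt0 mulr_gt0 // ltr_wpDl // frob_ge0. Qed.

Let W_lower (x : 'cV[R]_q) : frob x = 1 -> exists j, kW <= `|(W *m x) j 0|.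
Proof.
move=> x1; apply: large_coordinate; first exact: ltW.
have G1 : 0 < frob G + 1 by rewrite ltr_wpDl // frob_ge0.
have n1 : 0 < n%:R + 1 :> R by rewrite ltr_wpDl.
have GWx : 1 <= frob G * frob (W *m x).
  by rewrite -x1 -[x in leLHS]mul1mx -GW -mulmxA frobM.
have {}GWx : 1 <= (frob G + 1) * frob (W *m x).
  by rewrite (le_trans GWx) // ler_wpM2r ?frob_ge0 // lerDl.
rewrite (@lt_le_trans _ _ (frob G + 1)^-1) //.
  by rewrite /kW invfM mulrCA gtr_pMr ?invr_gt0 // ltr_pdivrMr // mul1r ltrDl.
by rewrite -div1r ler_pdivrMr // mulrC.
Qed.

Let kQ : R := (n%:R + 1)^-1.

Let kQ_gt0 : 0 < kQ.
Proof. by rewrite invr_gt0 ltr_wpDl. Qed.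

Let Q_lower (Q : 'M[R]_(n, p)) (x : 'cV[R]_p) : Q^T *m Q = 1%:M -> frob x = 1 ->
  exists j, kQ <= `|(Q *m x) j 0|.
Proof.
move=> QQ x1; apply: large_coordinate; first exact: ltW.
have n1 : 0 < n%:R + 1 :> R by rewrite ltr_wpDl.
by rewrite ortho_frob // x1 /kQ ltr_pdivrMr // mul1r ltrDl.
Qed.

Let Q_entry (Q : 'M[R]_(n, p)) a c : Q^T *m Q = 1%:M -> `|Q a c| <= 1.
Proof.
move=> QQ; have -> : Q a c = (Q *m delta_mx c 0 : 'cV[R]_n) a 0.
  by rewrite -colE mxE.
rewrite (le_trans (frob_entry _ _ _)) // ortho_frob //.
apply: frob_le => //; rewrite inner_sumE (bigD1 c) //= big_ord1 big1 ?addr0.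
  by rewrite mxE !eqxx mulr1 expr1n.
by move=> i ic; rewrite big_ord1 mxE (negPf ic) mul0r.
Qed.

Let entry1 (i : 'I_k) (j : 'I_n) : 'I_n * 'I_k + 'I_l * 'I_n := inl (j, i).
Let entry2 (i : 'I_l) (j : 'I_n) : 'I_n * 'I_k + 'I_l * 'I_n := inr (i, j).

Let entry1_mx w : entry_mx X entry1 w = (Psi_ w)^T.
Proof. by apply/matrixP => i j; rewrite !mxE. Qed.

Let entry2_mx w : entry_mx X entry2 w = Phi_ w.
Proof. by apply/matrixP => i j; rewrite !mxE. Qed.

Lemma measurable_qr_sketch (M : 'M[R]_n) (dT : measure_display)
    (T : measurableType dT) (Psi' : T -> 'M[R]_(n, k)) a c :
  (forall i j, measurable_fun [set: T] (fun w => Psi' w i j)) ->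
  measurable_fun [set: T] (fun w => (qr (M *m Psi' w)).1 a c).
Proof.
move=> mPsi; apply: (measurable_borel_entry (f := fun w => M *m Psi' w)
  (g := fun Y => (qr Y).1)); last by case: qrP.
move=> i j; rewrite (_ : (fun w => _) = fun w => \sum_h M i h * Psi' w h j).
  by apply: measurable_sum => h; apply: measurable_funM.
by apply/funext => w; rewrite mxE.
Qed.

Let rearr0 (u v x y z : R) : u * v * z * (x * y) = u * x * (v * y) * z.
Proof. by ring. Qed.

Let rearr1 (u v x y : R) : 2 * (u * y * (v * x)) = 2 * (u * v) * (x * y).
Proof. by ring. Qed.

Let rearr2 (u v x y z : R) : u * x * (v * y) * z = u * v * z * (x * y).
Proof. by ring. Qed.

(* At level j, entries of size at most 2^j and lower bounds 2^(-9j) for Psi^T W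
   and 2^(-5j) for Phi Q give an error factor of order 2^(16j); the grids of
   net_level then make the complement of this event of order 2^(-17j). *)
Lemma sketch_expectation : exists2 K, 0 < K &
  forall (M : 'M[R]_n) (N : 'M[R]_q) (D : R) (f : Omega -> R),
  0 < D -> frob (M - W *m N *m W^T) <= D ->
  (forall w, 0 <= f w <=
    frob (sketched_solution qr trunc (Psi_ w) (Phi_ w) M - W *m N *m W^T)) ->
  ('E_P[f] <= (K * D)%:E)%E.
Proof.
(* For r = 0 no [a] meets the condition of [net_level] with p = 0, l = 1 and the exponents below,
   but both matrices are then zero. *)
have [r0|r0] := posnP r.
  exists 1 => // M N D f D0 _ f_le; rewrite mul1r.
  suff -> : f = cst 0 by rewrite expectation_cst lee_fin ltW.
  apply/funext => w; apply/eqP; rewrite eq_le.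
  have /andP[-> f_le0] := f_le w; rewrite andbT (le_trans f_le0) //.
  have q0 : q = 0%N by apply/eqP; rewrite -leqn0 -[X in (_ <= X)%N]r0.
  have -> : W *m N *m W^T = 0.
    apply/eqP; rewrite -mxrank_eq0 -leqn0 (leq_trans (mxrankM_maxr _ _)) //.
    by rewrite (leq_trans (rank_leq_row _)) // q0.
  rewrite subr0 /sketched_solution.
  have [] := truncP.1
    (pseudoinverse (Phi_ w *m (qr (M *m Psi_ w)).1) *m (Phi_ w *m M)).
  by rewrite [X in (_ <= X)%N -> _]r0 leqn0 mxrank_eq0 => /eqP -> _;
    rewrite mulmx0 frob0.
have [Ct Ct0 tail] := tail_level normalX.
have entry1_inj i j i' j' : entry1 i j = entry1 i' j' -> i = i' /\ j = j'.
  by case=> -> ->.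
have entry2_inj i j i' j' : entry2 i j = entry2 i' j' -> i = i' /\ j = j'.
  by case=> -> ->.
(* The exponents a1 = 9 and a2 = 5 are forced at r = 1: the error grows like 2^((a1 + a2 + 2) j), so
   the tails must decay with exponent a1 + a2 + 3, while the two conditions of the form (a + 1) p +
   17 <= a l read 2 a1 >= 18 and 4 a2 >= 20. For larger r they have slack 8 (r - 1) or more. *)
have [C1 C10 net1] := net_level indepX normalX entry1_inj (a := 9) (p := q)
  kW_gt0 (frob_ge0 W) ltac:(lia).
have [C2 C20 net2] := net_level indepX normalX entry2_inj (a := 5) (p := p)
  kQ_gt0 ler01 ltac:(lia).
pose c1 : R := 2 * ((p * l)%:R * (l * n)%:R) + 3.
pose c2 : R := 1 + (n * k)%:R * (q * k)%:R * frob W.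
have c10 : 0 < c1 by rewrite ltr_wpDl // !mulr_ge0.
have c20 : 0 < c2 by rewrite ltr_wpDr // !mulr_ge0 ?frob_ge0.
have C0 : 0 <= Ct + C1 + C2 by rewrite !addr_ge0.
exists (c1 * c2 * (1 + (Ct + C1 + C2) * 2 ^+ 17)).
  by rewrite !mulr_gt0 // ltr_wpDr // mulr_ge0 // exprn_ge0.
move=> M N D f D0 MD f_le.
have QQ w : ((qr (M *m Psi_ w)).1)^T *m (qr (M *m Psi_ w)).1 = 1%:M.
  by have [_ ->] := qrP.1 (M *m Psi_ w).
have PsiE i i' : (fun w => Psi_ w i i') = X (inl (i, i')).
  by apply/funext => w; rewrite mxE.
(* Q is a function of Psi alone, so resampling an entry of Phi leaves it unchanged. *)
have mQ i j x y : measurable_fun [set: g_sigma_algebraType (others X (entry2 i j))]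
    (fun w => (qr (M *m Psi_ w)).1 x y).
  apply: measurable_qr_sketch => i' j'; rewrite PsiE.
  exact: measurable_others.
have mQ_Omega x y : measurable_fun [set: Omega] (fun w => (qr (M *m Psi_ w)).1 x y).
  by apply: measurable_qr_sketch => i' j'; rewrite PsiE; exact: measurable_funP.
have {}net1 := net1 (fun=> W) (fun _ _ _ _ => @measurable_cst _ _ _ _ _ _)
  (fun _ _ => @measurable_cst _ _ _ _ _ _)
  (fun _ => frob_entry W) (fun _ => W_lower).
have {}net2 := net2 (fun w => (qr (M *m Psi_ w)).1) mQ mQ_Omega
  (fun w a c => Q_entry a c (QQ w)) (fun w x => Q_lower (QQ w)).
have /choice[bad badP] : forall j, exists bad : set Omega, [/\ measurable bad,
    (P bad <= ((Ct + C1 + C2) / 2 ^+ (17 * j))%:E)%E &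
    forall w, ~ bad w -> f w <= c1 * c2 * D * 2 ^+ (16 * j)].
  move=> j; have [b0 [mb0 Pb0 b0P]] := tail j.
  have [b1 [mb1 Pb1 b1P]] := net1 j.
  have [b2 [mb2 Pb2 b2P]] := net2 j.
  exists (b0 `|` b1 `|` b2); split.
  - by apply: measurableU => //; exact: measurableU.
  - rewrite !mulrDl 2!EFinD; apply: le_trans (measureU2 _ _ _) _ => //.
      exact: measurableU.
    apply: leeD => //; apply: le_trans (measureU2 _ _ _) _ => //.
    exact: leeD.
  move=> w nb.
  have nb0 : ~ b0 w by move=> ?; apply: nb; left; left.
  have nb1 : ~ b1 w by move=> ?; apply: nb; left; right.
  have nb2 : ~ b2 w by move=> ?; apply: nb; right.
  have /andP[_ /le_trans] := f_le w; apply.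
  have Xle := b0P w nb0.
  have p2 (i : nat) : 0 < 2 ^+ i :> R by rewrite exprn_gt0.
  have p2_ge1 (i : nat) : 1 <= 2 ^+ i :> R by rewrite exprn_ege1 // ler1n.
  have PsiM : frob (Psi_ w) <= (n * k)%:R * 2 ^+ j.
    apply: frob_le_entry; first exact: ltW.
    by move=> i i'; rewrite mxE; exact: (Xle (inl (i, i'))).
  have PhiM : frob (Phi_ w) <= (l * n)%:R * 2 ^+ j.
    apply: frob_le_entry; first exact: ltW.
    by move=> i i'; rewrite mxE; exact: (Xle (inr (i, i'))).
  have W_ge := b1P w nb1 Xle; rewrite entry1_mx in W_ge.
  have Q_ge := b2P w nb2 Xle; rewrite entry2_mx in Q_ge.
  have s1 : 0 < (2 ^+ (9 * j))^-1 :> R by rewrite invr_gt0.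
  have s2 : 0 < (2 ^+ (5 * j))^-1 :> R by rewrite invr_gt0.
  have [qrE _ _] := qrP.1 (M *m Psi_ w).
  have := sketch_error N q_le_r qrE (QQ w) (truncP.1 _) s1 s2 W_ge Q_ge PsiM PhiM.
  rewrite !invrK => /le_trans; apply.
  rewrite [leRHS](_ : _ = (c1 * 2 ^+ (6 * j)) * (c2 * 2 ^+ (10 * j)) * D); last first.
    by rewrite (mulnDl 6%N 10%N j) exprD rearr0.
  have f1 : 2 * ((p * l)%:R * 2 ^+ (5 * j) * ((l * n)%:R * 2 ^+ j)) + 3 <=
      c1 * 2 ^+ (6 * j).
    rewrite /c1 [leRHS]mulrDl -[(6 * j)%N]/((1 + 5) * j)%N.
    rewrite (mulnDl 1%N 5%N j) mul1n exprD.
    by rewrite rearr1 lerD // ler_peMr // -exprD.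
  have f2 : 1 + (n * k)%:R * 2 ^+ j * ((q * k)%:R * 2 ^+ (9 * j)) * frob W <=
      c2 * 2 ^+ (10 * j).
    rewrite /c2 [leRHS]mulrDl -[(10 * j)%N]/((1 + 9) * j)%N.
    rewrite (mulnDl 1%N 9%N j) mul1n exprD.
    by rewrite rearr2 lerD // mul1r -exprD.
  have F1 : 0 <= 2 * ((p * l)%:R * 2 ^+ (5 * j) * ((l * n)%:R * 2 ^+ j)) + 3 :> R.
    by apply: addr_ge0 => //; rewrite !mulr_ge0 // ltW.
  have F2 : 0 <= 1 + (n * k)%:R * 2 ^+ j * ((q * k)%:R * 2 ^+ (9 * j)) * frob W.
    by rewrite addr_ge0 // !mulr_ge0 ?frob_ge0 // ltW.
  apply: ler_pM => //; [exact: mulr_ge0|exact: frob_ge0|exact: ler_pM].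
have f0 w : 0 <= f w by have /andP[] := f_le w.
have c0 : 0 < c1 * c2 * D by rewrite !mulr_gt0.
have mbad j : measurable (bad j) by have [] := badP j.
have Pbad j : (P (bad j) <= ((Ct + C1 + C2) / 2 ^+ (17 * j))%:E)%E.
  by have [] := badP j.
have fbad j w : ~ bad j w -> f w <= c1 * c2 * D * 2 ^+ (16 * j).
  by have [_ _] := badP j; exact.
have := expectation_le_levels c0 C0 f0 mbad Pbad fbad.
by rewrite mulrAC.
Qed.

End SketchExpectation.

(** * Distance to the solution set *)

Section Distance.
Context (R : realType) (m n : nat).
Implicit Types (A Z : 'M[R]_(m, n)) (S : set 'M[R]_(m, n)).

Lemma distF_ge0 A S : 0 <= distF A S.
Proof.
have [S0|/set0P[Z SZ]] := eqVneq S set0.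
  by rewrite /distF S0 image_set0 inf0.
apply: lb_le_inf; first by exists (frob (A - Z)), Z.
by move=> _ [Z' _ <-]; exact: frob_ge0.
Qed.

Lemma distF_le A S Z : S Z -> distF A S <= frob (A - Z).
Proof.
move=> SZ; apply: ge_inf; last by exists Z.
by exists 0 => _ [Z' _ <-]; exact: frob_ge0.
Qed.

End Distance.

Theorem theorem1p2 (R : realType) (n m r : nat)
    (C : 'M[R]_n) (A : {linear 'M[R]_n -> 'cV[R]_m}) (b : 'cV[R]_m)
    (y1 : 'cV[R]_m)
    (d : measure_display) (Omega : measurableType d) (P : probability Omega R)
    (Psi : 'I_n -> 'I_(2 * r + 1) -> {RV P >-> R})
    (Phi : 'I_(4 * r + 3) -> 'I_n -> {RV P >-> R})
    (qr : 'M[R]_(n, 2 * r + 1) ->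
       'M[R]_(n, minn n (2 * r + 1)) * 'M[R]_(minn n (2 * r + 1), 2 * r + 1))
    (trunc : 'M[R]_(minn n (2 * r + 1), n) ->
       'M[R]_(minn n (2 * r + 1), n)) :
  sym_mx C ->
  compact (primal_sol C A b) ->
  compact (dual_sol C A b) ->
  strong_duality C A b ->
  strict_complementarity C A b ->
  (forall X, primal_sol C A b X -> (\rank X <= r)%N) ->
  gaussian_sketch Psi Phi ->
  qr_routine qr ->
  rank_routine r trunc ->
  exists T : R -> nat,
    softO_at0 (fun e => (T e)%:R) (fun e => (e ^+ 2)^-1) /\
    forall e : R, 0 < e ->
    exists alpha rho beta : R,
      [/\ 0 < alpha, 0 < rho, 0 < beta < 1 &
      forall s : trajectory R n m, bundle_run C A b alpha rho beta y1 s ->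
      exists t : nat, (1 <= t <= T e)%N /\
        ('E_P[fun w => distF
            (sketched_solution qr trunc
              (random_matrix Psi w) (random_matrix Phi w) (bX s t))
            (primal_sol C A b)] <= (Num.sqrt e)%:E)%E].
Proof.
move=> symC _ _ [X0 [y0 [solX0 soly0 gap0]]] [Xs [ys [solXs solys rankXS]]].
move=> rank_le gauss qrP truncP.
have [feasXs optXs] := solXs; have [psdS optys] := solys.
(* The pair with zero duality gap need not be the strictly complementary one, but all solutions
   share the optimal values. *)
have gap : inner (- C) Xs = inner (- b) ys.
  have -> : inner (- C) Xs = inner (- C) X0.
    apply/eqP; rewrite eq_le; apply/andP; split; first exact: (proj2 solX0).
    exact: optXs (proj1 solX0).
  rewrite gap0; apply/eqP; rewrite eq_le; apply/andP; split.
    exact: (proj2 soly0).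
  exact: optys (proj1 soly0).
have [alpha [K1 [alpha0 K10 converges]]] :=
  bundle_converges symC y1 feasXs psdS gap.
have [c c0 growthP] := growth feasXs psdS gap rankXS (eq_row_base Xs) (ltW alpha0).
set W := (row_base Xs)^T in growthP.
have GW : (invmx (row_base Xs *m W) *m row_base Xs) *m W = 1%:M.
  by rewrite -mulmxA mulVmx // gram_unit // row_base_free.
have [K3 K30 sketch] := sketch_expectation gauss qrP truncP GW (rank_le _ solXs).
(* [L] bounds the factor from delta to the expected error; the 1 yields L >= 1, hence delta <= 1 as
   [growth] requires. *)
pose L := K3 * (c + 1) + 1.
have c1 : 0 < c + 1 by rewrite ltr_wpDl.
have L0 : 0 < L by rewrite ltr_wpDl // mulr_ge0 // ltW.
(* This is K1 / rho^2 for the rho chosen below. *)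
pose B (e : R) := K1 ^+ 3 * L ^+ 4 / (Num.min 1 e) ^+ 2.
pose T (e : R) := (Num.truncn (B e)).+2.
have num0 : 0 <= K1 ^+ 3 * L ^+ 4 by rewrite mulr_ge0 ?exprn_ge0 // ltW.
have B0 e : 0 <= B e by rewrite divr_ge0 // sqr_ge0.
exists T; split.
  (* No logarithm is lost; the 2 absorbs the rounding in [T], as 1 <= 1 / e^2 for e < 1. *)
  exists (K1 ^+ 3 * L ^+ 4 + 2), 0; near=> e.
  have e0 : 0 < e by near: e; exact: nbhs_right_gt.
  have e1 : e < 1 by near: e; exact: nbhs_right_lt.
  have e2 : 0 < e ^+ 2 by rewrite exprn_gt0.
  rewrite expr0 mul1r ger0_norm // ger0_norm ?invr_ge0 ?sqr_ge0 //.
  have /andP[TB _] := truncn_itv (B0 e).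
  rewrite /T -addn2 natrD mulrDl lerD //.
    by rewrite (le_trans TB) // /B min_r // ltW.
  by rewrite ler_peMr // invf_ge1 // exprn_ile1 // ltW.
move=> e e0; pose mu := Num.min 1 e.
have mu0 : 0 < mu by rewrite lt_min ltr01.
have mu1 : mu <= 1 by rewrite ge_min lexx.
have mue : mu <= e by rewrite ge_min lexx orbT.
pose delta := Num.sqrt mu / L.
have delta0 : 0 < delta by rewrite divr_gt0 // sqrtr_gt0.
have L1 : 1 <= L by rewrite lerDr mulr_ge0 // ltW.
have delta1 : delta <= 1.
  rewrite ler_pdivrMr // mul1r (le_trans _ L1) //.
  by rewrite -[leRHS]sqrtr1 ler_wsqrtr.
(* Both residuals of the run are then at most delta^2, the scale at which [growth] gives a distance
   of order delta. *)
pose rho := delta ^+ 2 / K1; have rho0 : 0 < rho by rewrite divr_gt0 // exprn_gt0.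
have K1rho : K1 * rho = delta ^+ 2 by rewrite mulrCA divff ?mulr1 // gt_eqF.
have T_ge : K1 / rho ^+ 2 <= (T e)%:R.
  have -> : K1 / rho ^+ 2 = B e.
    rewrite /rho /delta /B -/mu !expr_div_n sqr_sqrtr; last exact: ltW.
    by field; rewrite !gt_eqF.
  have /andP[_ /ltW TB] := truncn_itv (B0 e).
  by rewrite (le_trans TB) // ler_nat.
have T2 : (2 <= T e)%N by [].
exists alpha, rho, (1 + rho)^-1; split=> //.
  rewrite invr_gt0 addr_gt0 //= invf_lt1 ?addr_gt0 //; lra.
move=> s run.
have [t /andP[t2 tT] [splX AX SX]] := converges rho (T e) rho0 T2 T_ge s run.
exists t; split; first by rewrite tT ltnW.
rewrite K1rho in AX SX.
have [N [solN XN]] := growthP (bX s t) delta (ltW delta0) delta1 splX AX SX.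
have D0 : 0 < (c + 1) * delta by rewrite mulr_gt0.
have XD : frob (bX s t - W *m N *m W^T) <= (c + 1) * delta.
  by rewrite (le_trans XN) // ler_pM2r // lerDl.
apply: le_trans (sketch _ _ _ _ D0 XD _) _.
  by move=> w; rewrite distF_ge0 distF_le.
rewrite lee_fin mulrA /delta mulrA ler_pdivrMr // mulrC.
apply: ler_pM; rewrite ?sqrtr_ge0 ?mulr_ge0 ?(ltW c1) ?(ltW K30) //.
  exact: ler_wsqrtr.
by rewrite lerDl.
Unshelve. all: by end_near.
Qed.
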